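(* Let $T$ be a complete first-order theory with monster model $\mathfrak{C}$. The following are equivalent: (1) $T$ is simple. (2) Forking (in $T$) has dual finite character. (3) Forking (in $T$) has weak dual finite character.
   Context: Setting: $T$ is a complete first-order theory in a language $L(T)$, and $\mathfrak{C}$ is its monster model, i.e. a $\kappa$-saturated, strongly $\kappa$-homogeneous model of $T$ for a suitably large cardinal $\kappa > |L(T)|+\aleph_0$. As usual, all sets of parameters are small (of cardinality less than $\kappa$), all tuples and parameters are from $\mathfrak{C}$, and ''model'' means small elementary submodel of $\mathfrak{C}$. A formula is over $A$ if it has parameters from $A$; $\models\phi[\bar{a}]$ means $\mathfrak{C}\models\phi[\bar{a}]$. Dividing and forking: A formula $\phi(\bar{x},\bar{a})$ with parameters $\bar{a}$ divides over a set $A$ if there are $k<\omega$ and a sequence $\langle \bar{a}_i \mid i<\omega\rangle$ such that $\mathrm{tp}(\bar{a}_i/A)=\mathrm{tp}(\bar{a}/A)$ for all $i<\omega$ and $\{\phi(\bar{x},\bar{a}_i) \mid i<\omega\}$ is $k$-inconsistent (for any $i_1<\dots<i_k<\omega$, the formula $\bigwedge_{l=1}^{k}\phi(\bar{x},\bar{a}_{i_l})$ is not satisfiable in $\mathfrak{C}$). A type divides over $A$ if it implies a formula that divides over $A$. A type $p(\bar{x})$ forks over $A$ if there are finitely many formulas $\phi_0(\bar{x},\bar{a}_0),\dots,\phi_{n-1}(\bar{x},\bar{a}_{n-1})$ (with parameters anywhere in $\mathfrak{C}$), each dividing over $A$, such that $p(\bar{x}) \vdash \bigvee_{l<n}\phi_l(\bar{x},\bar{a}_l)$.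 A type is finitely satisfiable in $M$ if every finite subset of it is realized by a tuple from $M$. Simplicity: $T$ is simple if no formula has the tree property. A formula $\phi(\bar{x},\bar{y})$ has the tree property if there are $2 \le k<\omega$ and tuples $(\bar{a}_s)_{s\in \omega^{<\omega}}$ in $\mathfrak{C}$ such that for every $s\in\omega^{<\omega}$ the set $\{\phi(\bar{x},\bar{a}_{s^\frown \langle i\rangle}) \mid i<\omega\}$ is $k$-inconsistent, and for every $\eta\in\omega^\omega$ the set $\{\phi(\bar{x},\bar{a}_{\eta\upharpoonright n}) \mid 1\le n<\omega\}$ is consistent. Dual finite character (DFC): forking has DFC if for every set $A$ and all finite tuples $\bar{b},\bar{c}$ such that $\mathrm{tp}(\bar{c}/A\bar{b})$ forks over $A$, there is a formula $\phi(\bar{x},\bar{y})$ over $A$ such that $\models\phi[\bar{c},\bar{b}]$, and for every tuple $\bar{b}'$ (of the same arity as $\bar{b}$), $\models\phi[\bar{c},\bar{b}']$ implies that $\mathrm{tp}(\bar{c}/A\bar{b}')$ forks over $A$. Weak dual finite character (weak DFC): forking has weak DFC if for every model $M$ and all finite tuples $\bar{b},\bar{c}$ such that $\mathrm{tp}(\bar{c}/M\bar{b})$ divides over $M$, there is a formula $\phi(\bar{x},\bar{y})$ over $M$ such that $\models\phi[\bar{c},\bar{b}]$, and for every tuple $\bar{b}'$ (of the same arity as $\bar{b}$), $\models\phi[\bar{c},\bar{b}']$ implies that $\mathrm{tp}(\bar{c}/M\bar{b}')$ is not finitely satisfiable in $M$. *)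

(* Defs.v *)
From mathcomp Require Import all_boot.
From mathcomp Require Import mathcomp_extra boolp classical_sets functions cardinality.

Set Implicit Arguments.
Unset Strict Implicit.
Unset Printing Implicit Defensive.

Local Open Scope classical_set_scope.
Local Open Scope card_scope.

(* A (finite) n-tuple of elements of M is a function 'I_n -> M. *)

Definition tcat (M : Type) (n m : nat) (x : 'I_n -> M) (y : 'I_m -> M) :
    'I_(n + m) -> M :=
  fun i => match fintype.split i with inl j => x j | inr j => y j end.

Definition tcons (M : Type) (n : nat) (a : M) (x : 'I_n -> M) : 'I_n.+1 -> M :=
  fun i => if unlift ord0 i is Some j then x j else a.

Record language := Language {
  fsym : Type;
  farity : fsym -> nat;
  rsym : Type;
  rarity : rsym -> nat }.

(* Terms and formulas are scoped: their free variables are among the variables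
   indexed by 'I_n.  Equality is a logical symbol. *)

Inductive term (L : language) (n : nat) : Type :=
| Var of 'I_n
| App (f : fsym L) of ('I_(farity f) -> term L n).

Arguments Var {L n}.
Arguments App {L n}.

(* [All phi] binds the variable [ord0] of [phi]. *)
Inductive formula (L : language) : nat -> Type :=
| Bot n : formula L n
| Eq n of term L n & term L n : formula L n
| Rel n (r : rsym L) of ('I_(rarity r) -> term L n) : formula L n
| Imp n of formula L n & formula L n : formula L n
| All n of formula L n.+1 : formula L n.

Record structure (L : language) := Structure {
  dom :> Type;
  dom_inhabited : inhabited dom;
  finterp : forall f : fsym L, ('I_(farity f) -> dom) -> dom;
  rinterp : forall r : rsym L, ('I_(rarity r) -> dom) -> Prop }.

Fixpoint teval (L : language) (M : structure L) (n : nat) (v : 'I_n -> M)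
    (t : term L n) : M :=
  match t with
  | Var i => v i
  | App f ts => finterp (fun i => teval v (ts i))
  end.

Fixpoint sat (L : language) (M : structure L) (n : nat) (phi : formula L n) :
    ('I_n -> M) -> Prop :=
  match phi in formula _ n return ('I_n -> M) -> Prop with
  | Bot _ => fun _ => False
  | Eq _ t u => fun v => teval v t = teval v u
  | Rel _ r ts => fun v => rinterp (fun i => teval v (ts i))
  | Imp _ p q => fun v => sat p v -> sat q v
  | All _ p => fun v => forall a : M, sat p (tcons a v)
  end.

Definition sentence (L : language) := formula L 0.

Definition is_model (L : language) (T : set (sentence L)) (M : structure L) :=
  forall s, T s -> forall v : 'I_0 -> M, sat s v.

Definition entails (L : language) (T : set (sentence L)) (s : sentence L) :=
  forall M : structure L, is_model T M -> forall v : 'I_0 -> M, sat s v.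

Definition complete_theory (L : language) (T : set (sentence L)) :=
  (exists M : structure L, is_model T M) /\
  (forall s, entails T s \/ entails T (Imp s (Bot L 0))).

Definition fclosed (L : language) (M : structure L) (S : set M) :=
  forall (f : fsym L) (a : 'I_(farity f) -> M),
    (forall i, S (a i)) -> S (finterp a).

Definition substructure (L : language) (M : structure L) (S : set M)
    (S0 : inhabited {x : M | S x}) (Scl : fclosed S) : structure L :=
  @Structure L {x : M | S x} S0
    (fun f a => exist _ (finterp (fun i => sval (a i)))
                        (Scl f _ (fun i => proj2_sig (a i))))
    (fun r a => rinterp (fun i => sval (a i))).

Definition elementary_submodel (L : language) (M : structure L) (S : set M) :=
  exists (S0 : inhabited {x : M | S x}) (Scl : fclosed S),
    forall n (phi : formula L n) (v : 'I_n -> substructure S0 Scl),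
      sat phi v <-> @sat L M n phi (fun i => sval (v i)).

Definition tuple_in (M : Type) (n : nat) (A : set M) (a : 'I_n -> M) :=
  forall i, A (a i).

(* A formula phi(x, a) with parameters from M, where x is an n-tuple of
   variables and a a finite tuple of parameters. *)
Record pformula (L : language) (M : structure L) (n : nat) := PFormula {
  pnum : nat;
  pbody : formula L (n + pnum);
  pars : 'I_pnum -> M }.

Arguments pars {L M n} p _.

Definition pholds (L : language) (M : structure L) (n : nat)
    (P : pformula M n) (x : 'I_n -> M) :=
  sat (pbody P) (tcat x (pars P)).

Definition pover (L : language) (M : structure L) (n : nat)
    (A : set M) (P : pformula M n) :=
  tuple_in A (pars P).

Definition realizes (L : language) (M : structure L) (n : nat)
    (x : 'I_n -> M) (p : set (pformula M n)) :=
  forall P, p P -> pholds P x.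

Definition finitely_satisfiable (L : language) (M : structure L) (n : nat)
    (p : set (pformula M n)) (A : set M) :=
  forall q : set (pformula M n), finite_set q -> q `<=` p ->
    exists x : 'I_n -> M, tuple_in A x /\ realizes x q.

Definition consistent (L : language) (M : structure L) (n : nat)
    (p : set (pformula M n)) :=
  finitely_satisfiable p setT.

Definition tp (L : language) (M : structure L) (n : nat)
    (c : 'I_n -> M) (A : set M) : set (pformula M n) :=
  [set P | pover A P /\ pholds P c].

(* Cardinals are represented by types: kappa is the cardinal of K. *)
Definition card_lt (T U : Type) (A : set T) (B : set U) :=
  A #<= B /\ ~ (B #<= A).

Definition small (K T : Type) (A : set T) := card_lt A [set: K].

Definition saturated (K : Type) (L : language) (M : structure L) :=
  forall (A : set M) (n : nat) (p : set (pformula M n)),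
    small K A -> p `<=` pover A -> consistent p ->
    exists x : 'I_n -> M, realizes x p.

Definition automorphism (L : language) (M : structure L) (g : M -> M) :=
  [/\ bijective g,
      forall (f : fsym L) (a : 'I_(farity f) -> M),
        g (finterp a) = finterp (g \o a) &
      forall (r : rsym L) (a : 'I_(rarity r) -> M),
        rinterp a <-> rinterp (g \o a)].

(* f is only relevant on A: it represents a partial map with domain A. *)
Definition partial_elementary (L : language) (M : structure L)
    (A : set M) (f : M -> M) :=
  forall n (phi : formula L n) (a : 'I_n -> M), tuple_in A a ->
    sat phi a <-> sat phi (f \o a).

Definition strongly_homogeneous (K : Type) (L : language) (M : structure L) :=
  forall (A : set M) (f : M -> M), small K A -> partial_elementary A f ->
    exists g : M -> M, automorphism g /\ (forall x, A x -> g x = f x).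

(* The first clause is kappa > |L| + aleph_0. *)
Definition monster_model (K : Type) (L : language) (T : set (sentence L))
    (C : structure L) :=
  [/\ small K [set: fsym L + rsym L + nat], is_model T C,
      saturated K C & strongly_homogeneous K C].

Definition k_inconsistent (L : language) (C : structure L) (n m : nat)
    (phi : formula L (n + m)) (k : nat) (a : nat -> 'I_m -> C) :=
  forall s : 'I_k -> nat, (forall i j : 'I_k, i < j -> s i < s j) ->
    ~ exists x : 'I_n -> C, forall l, sat phi (tcat x (a (s l))).

Definition formula_divides (L : language) (C : structure L) (n : nat)
    (P : pformula C n) (A : set C) :=
  exists (k : nat) (a : nat -> 'I_(pnum P) -> C),
    (forall i, tp (a i) A = tp (pars P) A) /\ k_inconsistent (pbody P) k a.

(* Implication p |- ... is evaluated in the monster model C, as usual for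
   types p over small sets. *)
Definition divides (L : language) (C : structure L) (n : nat)
    (p : set (pformula C n)) (A : set C) :=
  exists Q : pformula C n, formula_divides Q A /\
    forall x : 'I_n -> C, realizes x p -> pholds Q x.

Definition forks (L : language) (C : structure L) (n : nat)
    (p : set (pformula C n)) (A : set C) :=
  exists (N : nat) (Q : 'I_N -> pformula C n),
    (forall l, formula_divides (Q l) A) /\
    forall x : 'I_n -> C, realizes x p -> exists l, pholds (Q l) x.

(* The finite sequences of naturals index the nodes of the tree, and
   [mkseq eta j] is the restriction of eta to j. *)
Definition tree_property (L : language) (C : structure L) (n m : nat)
    (phi : formula L (n + m)) :=
  exists (k : nat) (a : seq nat -> 'I_m -> C),
    [/\ 2 <= k,
        forall s : seq nat, k_inconsistent phi k (fun i => a (rcons s i)) &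
        forall eta : nat -> nat,
          consistent [set P | exists2 j, 1 <= j &
                                P = PFormula phi (a (mkseq eta j))]].

Definition simple_theory (L : language) (C : structure L) :=
  forall (n m : nat) (phi : formula L (n + m)), ~ tree_property C phi.

Definition dual_finite_character (K : Type) (L : language) (C : structure L) :=
  forall (A : set C) (m n : nat) (b : 'I_m -> C) (c : 'I_n -> C),
    small K A -> forks (tp c (A `|` range b)) A ->
    exists phi : pformula C (n + m),
      [/\ pover A phi, pholds phi (tcat c b) &
          forall b' : 'I_m -> C, pholds phi (tcat c b') ->
            forks (tp c (A `|` range b')) A].

Definition weak_dual_finite_character (K : Type) (L : language)
    (C : structure L) :=
  forall (M : set C) (m n : nat) (b : 'I_m -> C) (c : 'I_n -> C),
    elementary_submodel M -> small K M -> divides (tp c (M `|` range b)) M ->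
    exists phi : pformula C (n + m),
      [/\ pover M phi, pholds phi (tcat c b) &
          forall b' : 'I_m -> C, pholds phi (tcat c b') ->
            ~ finitely_satisfiable (tp c (M `|` range b')) M].

(* Main.v *)
From mathcomp Require Import all_boot.
From mathcomp Require Import boolp classical_sets functions cardinality filter.
Require Import Defs.

(* In a simple theory a tree rank of arbitrary sets is finite.  A nonempty set
   invariant under Aut(C/A) that forks over A would have infinite rank; hence
   nonforking extensions exist.  The rank would also be infinite if unboundedly
   many instances dividing over A were realized simultaneously along a
   sequence that is independent over A.  This gives both forking = dividing and
   symmetry, without indiscernible sequences.  For DFC: if tp(c/Ab) forks then
   tp(b/Ac) contains a formula phi(c, y) dividing over A, and phi(c, b') implies
   that tp(c/Ab') forks by symmetry.  DFC implies weak DFC since a type finitely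
   satisfiable in M does not fork over M.  If T has the tree property, a branch
   a_0, a_1, ... of the tree with realization c is chosen such that a_j has the
   same type as infinitely many of its siblings over the Skolem hull of the
   preceding terms.  Let M be the Skolem hull of the branch and b a limit of the a_j along
   an ultrafilter: phi(x, b) divides over M and phi(c, b), but tp(b/Mc) is finitely
   satisfiable in M, so any formula over M true of (c, b) is true of (c, b')
   with b' in M, and tp(c/Mb') = tp(c/M) is finitely satisfiable in M. *)

Set Implicit Arguments.
Unset Strict Implicit.
Unset Printing Implicit Defensive.

Local Open Scope classical_set_scope.
Local Open Scope card_scope.

(** * Cardinalities *)

(** Dividing is witnessed here by arbitrary sequences of conjugates; whatever uniformity an
    indiscernible sequence would supply is obtained from compactness instead. The rank is taken with
    respect to a set of formulas with bounds k. Simplicity bounds it for one such entry,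
    subadditivity for finitely many, and that suffices because a forking type implies a finite
    disjunction. The measured sets are merely invariant under automorphisms over a set: conjugating
    one dividing instance then yields infinitely many pieces of equal rank, which raises the rank of
    the whole set by one. In the converse direction the pigeonhole principle handles only finitely
    many formulas at a time. The Skolem hull therefore consists of names whose values belong to the
    unknown assignment, so that compactness and an ultrafilter limit can act on the hull together
    with the tree. Smallness is preserved by adding countable sets since kappa is uncountable; the
    other cardinality fact is that there are at most |L| + aleph_0 Skolem terms, which is why words
    over an infinite set are counted. *)

Definition embeds (T U : Type) := exists f : T -> U, injective f.

Lemma embeds_refl T : embeds T T.
Proof. by exists id. Qed.

Lemma embeds_trans T U V : embeds T U -> embeds U V -> embeds T V.
Proof. by move=> [f fi] [g gi]; exists (g \o f); apply: inj_comp. Qed.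

Lemma embeds_sum T T' U U' :
  embeds T T' -> embeds U U' -> embeds (T + U) (T' + U').
Proof.
move=> [f fi] [g gi].
exists (fun x => match x with inl a => inl (f a) | inr b => inr (g b) end).
by move=> [a|b] [a'|b'] //= [] => [/fi|/gi] ->.
Qed.

Lemma embeds_countType (T : countType) : embeds T nat.
Proof. by exists pickle; apply: (pcan_inj pickleK). Qed.

Lemma sval_inj T (P : T -> Prop) (x y : {x | P x}) : sval x = sval y -> x = y.
Proof. by case: x y => [x px] [y py] /= e; apply: eq_exist. Qed.

Lemma card_le_embeds T U (A : set T) (B : set U) :
  (A #<= B) <-> embeds {x | A x} {x | B x}.
Proof.
split.
- move/card_leP => [f].
  have fB (x : {x | A x}) : B (sval (f (exist _ (sval x) (mem_set (proj2_sig x))))).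

    by apply: set_mem; apply: (svalP (f _)).
  exists (fun x => exist _ _ (fB x)) => x y [] /val_inj.
  by move/(@inj _ _ _ f _ _ (in_setT _) (in_setT _)) => [] /sval_inj.
- move=> [f fi]; apply/card_leP.
  pose g (x : set_type A) : set_type B :=
    exist (fun y => is_true (y \in B)) _ (mem_set (proj2_sig (f (exist _ (sval x) (set_mem (proj2_sig x)))))).
  apply/injfunPex; exists g => // x y _ _.
  move=> [] /sval_inj /fi [] e.
  exact: val_inj.
Qed.

Definition smallT (K T : Type) := embeds T K /\ ~ embeds K T.

Lemma embeds_setT T : embeds T {x : T | setT x} /\ embeds {x : T | setT x} T.
Proof.
split; first by exists (fun x => exist _ x I) => x y [].
by exists sval; apply: sval_inj.
Qed.

Lemma smallP K T (A : set T) : small K A <-> smallT K {x | A x}.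
Proof.
rewrite /small /card_lt !card_le_embeds /smallT.
have [KK' K'K] := embeds_setT K.
split=> -[H1 H2]; split.
- exact: embeds_trans H1 _.
- by move=> H; apply: H2; apply: embeds_trans H.
- exact: embeds_trans H1 _.
- by move=> H; apply: H2; apply: embeds_trans H.
Qed.

Lemma smallT_embeds K T U : embeds T U -> smallT K U -> smallT K T.
Proof.
move=> TU [UK KU]; split; first exact: embeds_trans UK.
by move=> KT; apply: KU; apply: embeds_trans TU.
Qed.

(** Hilbert's hotel: the copy of [nat] inside [T] moves to its even places, and the added [nat]
    takes the odd ones. *)
Lemma embeds_sum_nat T : embeds nat T -> embeds (T + nat) T.
Proof.
move=> [e ei].
pose g (x : T) : T :=
  if pselect (exists n, e n = x) is left h then e (sval (cid h)).*2 else x.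
have gN x : ~ (exists n, e n = x) -> g x = x by rewrite /g; case: pselect.
have gE n : g (e n) = e n.*2.
  rewrite /g; case: pselect => [h|]; last by case; exists n.
  by case: (cid h) => /= m /ei ->.
exists (fun x => match x with inl a => g a | inr n => e n.*2.+1 end).
have aux x n : g x <> e n.*2.+1.
  have [[m <-]|h] := pselect (exists m, e m = x).
    by rewrite gE => /ei /(congr1 odd) /=; rewrite !odd_double.
  by rewrite gN // => h'; apply: h; eexists; exact: esym h'.
move=> [x|n] [y|m] //=.
- have [[n <-]|hx] := pselect (exists m, e m = x);
  have [[m <-]|hy] := pselect (exists m, e m = y).
  + by rewrite !gE => /ei /double_inj ->.
  + by rewrite gE gN // => h; case: hy; eexists; exact: h.
  + by rewrite gE gN // => h; case: hx; eexists; exact: esym h.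
  + by rewrite !gN // => ->.
- by move/aux.
- by move/esym/aux.
- by move/ei => -[] /double_inj ->.
Qed.

Lemma embeds_natVfin T : embeds nat T \/ embeds T nat.
Proof.
have [h|h] := pselect (finite_set [set: T]).
  right; move/finite_set_countable: h => /card_le_embeds h.
  apply: embeds_trans (proj2 (embeds_setT nat)).
  exact: embeds_trans (proj1 (embeds_setT T)) h.
left; move/infiniteP/card_le_embeds: h => h.
apply: embeds_trans (proj2 (embeds_setT T)).
exact: embeds_trans (proj1 (embeds_setT nat)) h.
Qed.

(** An infinite [T] absorbs a countable summand; otherwise the whole sum is countable. *)
Lemma smallT_sum_nat K T U : smallT K nat -> smallT K T -> embeds U nat ->
  smallT K (T + U).
Proof.
move=> Kn KT Un.
have h : smallT K (T + nat).
  have [nT|Tn] := embeds_natVfin T.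
    exact: smallT_embeds (embeds_sum_nat nT) KT.
  apply: smallT_embeds Kn.
  exact: embeds_trans (embeds_sum Tn (embeds_refl nat)) (embeds_countType (nat + nat)%type).
apply: smallT_embeds h; exact: embeds_sum (embeds_refl T) Un.
Qed.

(** A maximal partial injection leaves no point uncovered on at least one side, or else a pair could
    be added. *)
Lemma embeds_total T U : embeds T U \/ embeds U T.
Proof.
pose P (G : set (T * U)) :=
  (forall x y y', G (x, y) -> G (x, y') -> y = y') /\
  (forall x x' y, G (x, y) -> G (x', y) -> x = x').
have [F FP Ftot|G [[Gf Gi] Gmax]] := @Zorn_bigcup _ P.
  split=> [x y y'|x x' y] [G1 F1 h1] [G2 F2 h2];
    have [s|s] := Ftot _ _ F1 F2.
  - exact: (FP _ F2).1 (s _ h1) h2.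
  - exact: (FP _ F1).1 h1 (s _ h2).
  - exact: (FP _ F2).2 (s _ h1) h2.
  - exact: (FP _ F1).2 h1 (s _ h2).
have [hT|hT] := pselect (forall x, exists y, G (x, y)).
  left; have [f fG] := choice hT.
  by exists f => x x' e; apply: Gi (fG x) _; rewrite e; apply: fG.
have [hU|hU] := pselect (forall y, exists x, G (x, y)).
  right; have [f fG] := choice hU.
  by exists f => x x' e; apply: Gf (fG x) _; rewrite e; apply: fG.
move/existsNP: hT => [x0 hx]; move/existsNP: hU => [y0 hy].
exfalso; apply: (Gmax (G `|` [set (x0, y0)])).
  split; first by move=> z Gz; left.
  by move=> h; apply: hx; exists y0; apply: h; right.
split=> [x y y'|x x' y] [h1|[e1 e2]] [h2|[e3 e4]]; subst=> //.
- exact: Gf h1 h2.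
- by case: hx; exists y.
- by case: hx; exists y'.
- exact: Gi h1 h2.
- by case: hy; exists x.
- by case: hy; exists x'.
Qed.

(* Let X <= S be maximal such that the words over X embed into X.  If S \ X
   embeds into X, so does S; otherwise S \ X contains a copy Y of X, and the
   words over X and Y that are not words over X can be coded by letters of Y. *)
Section Words.
Variables (S : choiceType) (e : nat -> S).
Hypothesis ei : injective e.

Let letter (G : set (seq S * S)) x := exists z, G ([:: x], z).

(** [G] is the graph of an injection of the words over X into X. The set X is recovered from [G] as
    its letters, so Zorn's lemma has a single relation to enlarge. *)
Let coding (G : set (seq S * S)) := [/\
  forall s y y', G (s, y) -> G (s, y') -> y = y',
  forall s s' y, G (s, y) -> G (s', y) -> s = s',
  forall s y, G (s, y) -> letter G y,
  forall s y x, G (s, y) -> x \in s -> letter G x &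
  forall s, (forall x, x \in s -> letter G x) -> exists y, G (s, y)].

Let G0 : set (seq S * S) := [set p | exists s, p = (map e s, e (pickle s))].

Let letterG0 n : letter G0 (e n).
Proof. by exists (e (pickle [:: n])), [:: n]. Qed.

Let coding0 : coding G0.
Proof.
split.
- move=> s y y' [t [E ->]] [t' [E' ->]].
  by rewrite (inj_map ei (etrans (esym E) E')).
- move=> s s' y [t [-> E]] [t' [-> E']].
  by rewrite (pcan_inj pickleK (ei (etrans (esym E) E'))).
- by move=> s y [t [_ ->]]; apply: letterG0.
- by move=> s y x [t [-> _]] /mapP [n _ ->]; apply: letterG0.
- move=> s hs.
  suff [t ->] : exists t, s = map e t by exists (e (pickle t)), t.
  elim: s hs => [|x s IH] hs; first by exists [::].
  have [t ->] : exists t, s = map e t.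
    by apply: IH => y ys; apply: hs; rewrite inE ys orbT.
  have [z [[|n [|m u]]] [] // -> _] := hs x (mem_head _ _).
  by exists (n :: t).
Qed.

Let coding_max : exists G, coding G /\ forall H, G `<=` H -> coding H -> H `<=` G.
Proof.
(* Zorn's lemma also asks about the empty chain, whose union is empty; adjoining [G0] to every
   relation makes that case a coding too. *)
have [F FP Ftot|G [cG Gmax]] := @Zorn_bigcup _ (fun G => coding (G `|` G0)).
  have [[H0 FH0]|F0] := pselect (F !=set0); last first.
    suff -> : \bigcup_(X in F) X = set0 by rewrite set0U; apply: coding0.
    by apply/seteqP; split=> x // [X FX _]; apply: F0; exists X.
  pose U := \bigcup_(X in F) X `|` G0.
  have UF z : U z -> exists2 H, F H & (H `|` G0) z.
    by move=> [[H FH Hz]|]; [exists H => //; left | exists H0 => //; right].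
  have FU H z : F H -> (H `|` G0) z -> U z.
    by move=> FH [Hz|]; [left; exists H|right].
  have UF2 z z' : U z -> U z' ->
      exists2 H, F H & (H `|` G0) z /\ (H `|` G0) z'.
    move=> /UF [H1 F1 h1] /UF [H2 F2 h2].
    have [s|s] := Ftot _ _ F1 F2.
    - by exists H2 => //; split=> //; case: h1; [left; apply: s|right].
    - by exists H1 => //; split=> //; case: h2; [left; apply: s|right].
  have Ul H x : F H -> letter (H `|` G0) x -> letter U x.
    by move=> FH [z hz]; exists z; apply: FU hz.
  rewrite -/U; split.
  - move=> s y y' h h'; have [H /FP [+ _ _ _ _] [h1 h2]] := UF2 _ _ h h'.
    by apply; [exact: h1|].
  - move=> s s' y h h'; have [H /FP [_ + _ _ _] [h1 h2]] := UF2 _ _ h h'.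
    by apply; [exact: h1|].
  - move=> s y /UF [H FH h]; apply: (Ul _ _ FH).
    by have [_ _ + _ _] := FP _ FH; apply; exact: h.
  - move=> s y x /UF [H FH h] xs; apply: (Ul _ _ FH).
    by have [_ _ _ + _] := FP _ FH; apply; [exact: h|].
  - move=> s hs.
    suff [H FH h] : exists2 H, F H & forall x, x \in s -> letter (H `|` G0) x.
      by have [_ _ _ _ /(_ _ h) [y hy]] := FP _ FH; exists y; apply: FU hy.
    elim: s hs => [|x s IH] hs; first by exists H0.
    have [|H1 F1 h1] := IH.
      by move=> y ys; apply: hs; rewrite inE ys orbT.
    have [z /UF [H2 F2 h2]] := hs x (mem_head _ _).
    have [l|l] := Ftot _ _ F1 F2.
    + exists H2 => // y; rewrite inE => /orP [/eqP ->|/h1 [w hw]].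
        by exists z.
      by exists w; case: hw; [left; apply: l|right].
    + exists H1 => // y; rewrite inE => /orP [/eqP ->|/h1//].
      by exists z; case: h2; [left; apply: l|right].
exists (G `|` G0); split=> // H GH cH z Hz; apply: contrapT => Gz.
apply: (Gmax H); last by rewrite setUidl // => w hw; apply: GH; right.
split; first by move=> w hw; apply: GH; left.
by move=> HG; apply: Gz; left; apply: HG.
Qed.

Lemma embeds_seq : embeds (seq S) S.
Proof.
have [G [[Gf Gi Gr Gd Gt] Gmax]] := coding_max.
pose X := [set x | letter G x].
have /choice [f fG] : forall s, exists y : S,
    (forall x, x \in s -> X x) -> G (s, y).
  move=> s; have [h|h] := pselect (forall x, x \in s -> X x).
    by have [y] := Gt s h; exists y.
  by exists (e 0).
have Xf s : (forall x, x \in s -> X x) -> X (f s) by move=> /fG /Gr.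
have finj s t : (forall x, x \in s -> X x) -> (forall x, x \in t -> X x) ->
    f s = f t -> s = t.
  by move=> /fG + /fG + E; rewrite E => h1 h2; apply: Gi h1 h2.
have X0 : X (f [::]) by apply: Xf.
pose x0 := f [::].
(* c1 and c2 are injections of X into X with disjoint ranges. *)
pose c1 x := f [:: x0; x]; pose c2 x := f [:: x0; x0; x].
have in1 x : X x -> forall y, y \in [:: x0; x] -> X y.
  by move=> xX y; rewrite !inE => /orP [] /eqP ->.
have in2 x : X x -> forall y, y \in [:: x0; x0; x] -> X y.
  by move=> xX y; rewrite !inE => /or3P [] /eqP ->.
pose Y := [set x | ~ X x].
have [[g gi]|[g gi]] := embeds_total {x | Y x} {x | X x}.
- pose h x := match pselect (X x) with
    | left _ => c1 x | right n => c2 (sval (g (exist Y x n))) end.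
  have hX x : X (h x).
    rewrite /h; case: pselect => [xX|n]; apply: Xf.
      exact: in1.
    by apply: in2; apply: (proj2_sig (g _)).
  have hi : injective h.
    move=> x y; rewrite /h; case: pselect => a; case: pselect => b.
    + by move/finj => /(_ (in1 _ a) (in1 _ b)) [].
    + by move/finj => /(_ (in1 _ a) (in2 _ (proj2_sig (g _)))).
    + by move/finj => /(_ (in2 _ (proj2_sig (g _))) (in1 _ b)).
    + move/finj => /(_ (in2 _ (proj2_sig (g _))) (in2 _ (proj2_sig (g _)))).
      by case=> /sval_inj /gi [].
  exists (f \o map h) => s t /= /finj E; apply: (inj_map hi); apply: E.
    by move=> x /mapP [y _ ->].
  by move=> x /mapP [y _ ->].
- pose y x := if pselect (X x) is left a then sval (g (exist _ x a)) else x.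
  have yY x : X x -> Y (y x).
    by rewrite /y; case: pselect => // a _; apply: (proj2_sig (g _)).
  have yi x x' : X x -> X x' -> y x = y x' -> x = x'.
    rewrite /y; case: pselect => // a _; case: pselect => // b _.
    by move=> /sval_inj /gi [].
  pose Z x := X x \/ exists2 x', X x' & x = y x'.
  have /choice [h hP] : forall x, exists z,
      (X x -> z = c1 x) /\ (forall x', X x' -> x = y x' -> z = c2 x').
    move=> x; have [a|a] := pselect (X x).
      exists (c1 x); split=> // x' X' E; exfalso.
      by apply: (yY _ X'); rewrite -E.
    have [[x' X' E]|b] := pselect (exists2 x', X x' & x = y x').
      exists (c2 x'); split=> // x'' X'' E'; congr c2.
      by apply: yi => //; rewrite -E -E'.
    by exists x; split=> // x' X' E; exfalso; apply: b; exists x'.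
  have hX x : Z x -> X (h x).
    move=> [a|[x' X' E]].
      by rewrite (hP x).1 //; apply: Xf; apply: in1.
    by rewrite ((hP x).2 x') //; apply: Xf; apply: in2.
  have hi x x' : Z x -> Z x' -> h x = h x' -> x = x'.
    move=> [a|[u Xu E]] [b|[v Xv E']].
    + rewrite (hP x).1 // (hP x').1 // => /finj.
      by move=> /(_ (in1 _ a) (in1 _ b)) [].
    + rewrite (hP x).1 // ((hP x').2 v) // => /finj.
      by move=> /(_ (in1 _ a) (in2 _ Xv)).
    + rewrite ((hP x).2 u) // (hP x').1 // => /finj.
      by move=> /(_ (in2 _ Xu) (in1 _ b)).
    + rewrite ((hP x).2 u) // ((hP x').2 v) // => /finj.
      by move=> /(_ (in2 _ Xu) (in2 _ Xv)) [] uv; rewrite E E' uv.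
  have hsX s : (forall x, x \in s -> Z x) -> forall x, x \in map h s -> X x.
    by move=> sZ x /mapP [z /sZ + ->]; apply: hX.
  pose H := G `|` [set p | [/\ forall x, x \in p.1 -> Z x,
    ~ (forall x, x \in p.1 -> X x) & p.2 = y (f (map h p.1))]].
  have lX x : X x -> letter H x by move=> [z Gz]; exists z; left.
  have lZ x : Z x -> letter H x.
    move=> Zx; have [/lX//|nX] := pselect (X x).
    exists (y (f (map h [:: x]))); right; split=> //.
      by move=> z; rewrite inE => /eqP ->.
    by move=> /(_ x (mem_head _ _)).
  have lZ' x : letter H x -> Z x.
    move=> [z [Gz|[/= Zx _ _]]]; last by apply: Zx; rewrite mem_head.
    by left; exists z.
  have GX s z : G (s, z) -> forall x, x \in s -> X x.
    by move=> Gs x; apply: Gd Gs.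
  have cH : coding H.
    split.
    + move=> s z z' [G1|[/= Z1 X1 ->]] [G2|[/= Z2 X2 ->]] //.
      * exact: Gf G1 G2.
      * by case: X2; apply: GX G1.
      * by case: X1; apply: GX G2.
    + move=> s s' z [G1|[/= Z1 X1 E1]] [G2|[/= Z2 X2 E2]].
      * exact: Gi G1 G2.
      * case: (yY (f (map h s'))); first by apply/Xf/hsX.
        by rewrite -E2; apply: Gr G1.
      * case: (yY (f (map h s))); first by apply/Xf/hsX.
        by rewrite -E1; apply: Gr G2.
      * move: E1; rewrite E2 => /yi E.
        have {}E : map h s' = map h s.
          by apply: finj; [exact: hsX|exact: hsX|apply: E; apply/Xf/hsX].
        elim: s s' Z1 Z2 E {X1 X2 E2} => [|x s IH] [|x' s'] //= Z1 Z2 [Ex Es].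
        congr (_ :: _).
          by apply: hi; rewrite ?Ex //; [apply: Z1|apply: Z2]; rewrite mem_head.
        by apply: IH => // z' zs; [apply: Z1|apply: Z2]; rewrite inE zs orbT.
    + move=> s z [/Gr/lX//|[/= Zs _ ->]].
      by apply: lZ; right; exists (f (map h s)) => //; apply/Xf/hsX.
    + move=> s z x [Gz|[/= Zs _ _]] xs; apply: lZ; last exact: Zs.
      by left; apply: GX Gz _ xs.
    + move=> s ls; have [/Gt [z Gz]|nX] := pselect (forall x, x \in s -> X x).
        by exists z; left.
      exists (y (f (map h s))); right; split=> //= x /ls; exact: lZ'.
  (* By maximality [y (f [::])] would already be a letter of [G], although [y] maps X outside X. *)
  have sHG : H `<=` G by apply: Gmax => // z Gz; left.
  exfalso; apply: (yY _ X0).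
  have [z Hz] : letter H (y (f [::])) by apply: lZ; right; exists (f [::]).
  by exists z; apply: sHG.
Qed.

End Words.

Lemma embeds_words S : embeds nat S -> embeds (seq S) S.
Proof. by move=> [e ei]; apply: (@embeds_seq {classic S} e ei). Qed.

(** * Definability *)

Lemma tcat_lshift M n m (x : 'I_n -> M) (y : 'I_m -> M) i :
  tcat x y (lshift m i) = x i.
Proof. by rewrite /tcat; case: split_ordP => j /eqP; rewrite ?eq_shift // => /eqP ->. Qed.

Lemma tcat_rshift M n m (x : 'I_n -> M) (y : 'I_m -> M) i :
  tcat x y (rshift n i) = y i.
Proof. by rewrite /tcat; case: split_ordP => j /eqP; rewrite ?eq_shift // => /eqP ->. Qed.

Lemma tcat_comp M N (f : M -> N) n m (x : 'I_n -> M) (y : 'I_m -> M) :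
  f \o tcat x y = tcat (f \o x) (f \o y).
Proof. by apply/funext => i; rewrite /tcat /=; case: fintype.split. Qed.

Lemma tcons0 M n (a : M) (x : 'I_n -> M) : tcons a x ord0 = a.
Proof. by rewrite /tcons unlift_none. Qed.

Lemma tcons_lift M n (a : M) (x : 'I_n -> M) i : tcons a x (lift ord0 i) = x i.
Proof. by rewrite /tcons liftK. Qed.

Lemma tcons_comp M N (f : M -> N) n (a : M) (x : 'I_n -> M) :
  f \o tcons a x = tcons (f a) (f \o x).
Proof. by apply/funext => i; rewrite /tcons /=; case: unlift. Qed.

Lemma tcons_eta M n (x : 'I_n.+1 -> M) : tcons (x ord0) (x \o lift ord0) = x.
Proof.
by apply/funext => i; rewrite /tcons; case: unliftP => [j|] ->.
Qed.

Definition noord M (i : 'I_0) : M := match notF (ltn_ord i) with end.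

Section Renaming.
Variable L : language.

Fixpoint tren n m (h : 'I_n -> 'I_m) (t : term L n) : term L m :=
  match t with
  | Var i => Var (h i)
  | App f ts => App f (fun i => tren h (ts i))
  end.

Definition hlift n m (h : 'I_n -> 'I_m) : 'I_n.+1 -> 'I_m.+1 :=
  tcons ord0 (lift ord0 \o h).

Fixpoint fren n (phi : formula L n) : forall m, ('I_n -> 'I_m) -> formula L m :=
  match phi in formula _ n return forall m, ('I_n -> 'I_m) -> formula L m with
  | Bot _ => fun m _ => Bot L m
  | Eq _ t u => fun m h => Eq (tren h t) (tren h u)
  | Rel _ r ts => fun m h => @Rel L m r (fun i => tren h (ts i))
  | Imp _ p q => fun m h => Imp (fren p h) (fren q h)
  | All _ p => fun m h => All (fren p (hlift h))
  end.

Variable M : structure L.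

Lemma teval_tren n m (h : 'I_n -> 'I_m) (v : 'I_m -> M) t :
  teval v (tren h t) = teval (v \o h) t.
Proof. by elim: t => //= f ts IH; congr finterp; apply/funext. Qed.

Lemma sat_fren n (phi : formula L n) m (h : 'I_n -> 'I_m) (v : 'I_m -> M) :
  sat (fren phi h) v <-> sat phi (v \o h).
Proof.
elim: phi m h v => {n} [n|n t u|n r ts|n p IHp q IHq|n p IH] m h v /=.
- by [].
- by rewrite !teval_tren.
- by rewrite (_ : (fun i => _) = fun i => teval (v \o h) (ts i)) //;
    apply/funext => i; rewrite teval_tren.
- by rewrite IHp IHq.
- suff E a : tcons a v \o hlift h = tcons a (v \o h).
    by split=> + a => /(_ a); rewrite IH E.
  rewrite /hlift tcons_comp tcons0; congr tcons.
  by apply/funext => i /=; rewrite tcons_lift.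
Qed.

End Renaming.

Definition scase V W M (x : V -> M) (y : W -> M) : V + W -> M :=
  fun w => match w with inl v => x v | inr u => y u end.

Section Definability.
Variables (L : language) (C : structure L).
Implicit Types (A B : set C).

Definition asg V (f : V -> C) : V + C -> C := scase f id.

(* X is cut out by a formula whose variables are interpreted by elements of V
   or by parameters in A; the variable type V is arbitrary. *)
Definition definable A V (X : set (V -> C)) :=
  exists n (phi : formula L n) (g : 'I_n -> V + C),
    (forall i c, g i = inr c -> A c) /\
    forall f, X f <-> sat phi (asg f \o g).

Lemma def_ext A V (X Y : set (V -> C)) : (forall f, X f <-> Y f) ->
  definable A X -> definable A Y.
Proof.
by move=> E [n [phi [g [gA H]]]]; exists n, phi, g; split=> // f; rewrite -E.
Qed.

Lemma def_sat A V n (phi : formula L n) (g : 'I_n -> V) :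
  definable A [set f : V -> C | sat phi (f \o g)].
Proof. by exists n, phi, (inl \o g). Qed.

Lemma def_imp A V (X Y : set (V -> C)) : definable A X -> definable A Y ->
  definable A [set f | X f -> Y f].
Proof.
move=> [n [phi [g [gA gE]]]] [m [psi [h [hA hE]]]].
exists (n + m), (Imp (fren phi (@lshift n m)) (fren psi (@rshift n m))), (tcat g h).
split=> [i c|f].
  by rewrite /tcat; case: fintype.split => j; [apply: gA|apply: hA].
rewrite /= !sat_fren gE hE.
rewrite (_ : _ \o lshift m = asg f \o g).
  by rewrite (_ : _ \o @rshift n m = asg f \o h) //;
    apply/funext => i /=; rewrite tcat_rshift.
by apply/funext => i /=; rewrite tcat_lshift.
Qed.

Lemma def_bot A V : definable A (@set0 (V -> C)).
Proof.
exists 0, (Bot L 0), (@noord _).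
by split=> // -[].
Qed.

Lemma def_not A V (X : set (V -> C)) : definable A X -> definable A (~` X).
Proof. by move=> /def_imp /(_ (def_bot A V)); apply: def_ext. Qed.

Lemma def_top A V : definable A (@setT (V -> C)).
Proof. by apply: def_ext (def_not (def_bot A V)) => f; split=> // _ []. Qed.

Lemma def_and A V (X Y : set (V -> C)) : definable A X -> definable A Y ->
  definable A (X `&` Y).
Proof.
move=> dX dY; apply: def_ext (def_not (def_imp dX (def_not dY))) => f /=.
split=> [H|[hX hY] H]; last exact: H.
by apply: contrapT => H'; apply: H => hX hY; apply: H'.
Qed.

Lemma def_or A V (X Y : set (V -> C)) : definable A X -> definable A Y ->
  definable A (X `|` Y).
Proof.
move=> dX dY; apply: def_ext (def_imp (def_not dX) dY) => f /=.
split=> [H|[hX //|//]].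
by have [h|h] := pselect (X f); [left|right; apply: H].
Qed.

Lemma def_all A V N (X : 'I_N -> set (V -> C)) : (forall i, definable A (X i)) ->
  definable A [set f | forall i, X i f].
Proof.
elim: N X => [|N IH] X dX.
  by apply: def_ext (def_top A V) => f; split=> // _ [].
apply: def_ext (def_and (dX ord0) (IH (X \o lift ord0) _)) => [f|i]; last exact: dX.
split=> [[h0 h] i|h]; last by split=> [|i]; apply: h.
by case: (unliftP ord0 i) => [j|] ->; [apply: h|].
Qed.

Lemma def_exI A V N (X : 'I_N -> set (V -> C)) : (forall i, definable A (X i)) ->
  definable A [set f : V -> C | exists i, X i f].
Proof.
move=> dX; apply: def_ext (def_not (def_all (fun i => def_not (dX i)))) => f.
split=> [/= /existsNP [i /contrapT h]|[i h] /(_ i)//]; by exists i.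
Qed.

Lemma def_const A V (P : Prop) : definable A [set f : V -> C | P].
Proof.
have [h|h] := pselect P; first by apply: def_ext (def_top A V) => f.
by apply: def_ext (def_bot A V) => f.
Qed.

Lemma def_eq A V (u w : V + C) : (forall c, u = inr c -> A c) ->
  (forall c, w = inr c -> A c) -> definable A [set f : V -> C | asg f u = asg f w].
Proof.
move=> hu hw; exists 2, (Eq (Var ord0) (Var ord_max)),
  (fun i => if i == ord0 then u else w).
by split=> [i c|f] //=; case: ifP => _; auto.
Qed.

Lemma def_subst A B V W (X : set (V -> C)) (h : V -> W + C) : A `<=` B ->
  (forall v c, h v = inr c -> B c) -> definable A X ->
  definable B [set f : W -> C | X (asg f \o h)].
Proof.
move=> AB hB [n [phi [g [gA gE]]]].
exists n, phi, (fun i => match g i with inl v => h v | inr c => inr c end).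
split=> [i c|f].
  case E : (g i) => [v|d]; first exact: hB.
  by move=> [<-]; apply/AB/(gA _ _ E).
rewrite /= gE (_ : _ \o _ = asg (asg f \o h) \o g) //.
by apply/funext => i /=; case: (g i).
Qed.

Lemma def_sub A B V (X : set (V -> C)) : A `<=` B -> definable A X -> definable B X.
Proof. by move=> AB; apply: (@def_subst A B V V X inl). Qed.

Lemma def_ren A V W (X : set (V -> C)) (h : V -> W) : definable A X ->
  definable A [set f : W -> C | X (f \o h)].
Proof. exact: (@def_subst A A V W X (inl \o h)). Qed.

Lemma def_ex1 A V (X : set (V + unit -> C)) : definable A X ->
  definable A [set f : V -> C | exists a, X (scase f (fun=> a))].
Proof.
move=> [n [phi [g [gA gE]]]].
pose ok (w : V + C) := forall c, w = inr c -> A c.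
pose proj (w : V + unit + C) : option (V + C) :=
  match w with inl (inl v) => Some (inl v) | inl (inr _) => None
  | inr c => Some (inr c) end.
have okg i w : proj (g i) = Some w -> ok w.
  case E : (g i) => [[v|[]]|c] //= [<-] d //.
  by move=> [<-]; apply: gA E.
pose ex m (p : formula L m.+1) := Imp (All (Imp p (Bot L _))) (Bot L _).
have exE m (p : formula L m.+1) (v : 'I_m -> C) :
    sat (ex m p) v <-> exists a, sat p (tcons a v).
  split=> [h|[a h] /(_ a)//]; apply: contrapT => h'; apply: h => a pa.
  by apply: h'; exists a.
(* All positions that name the quantified variable are redirected to [ord0]. Their old slots still
   need an admissible interpretation, for which any [w0] will do. *)
have [[w0 okw0]|h0] := pselect (exists w0, ok w0).
  pose h (i : 'I_n) : 'I_n.+1 := if proj (g i) is Some _ then lift ord0 i else ord0.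
  exists n, (ex _ (fren phi h)), (fun i => odflt w0 (proj (g i))).
  split=> [i c|f].
    by case E : (proj (g i)) => [w|] //=; [exact: (okg _ _ E c)|exact: (okw0 c)].
  rewrite exE /=; split=> -[a H]; exists a; move: H; rewrite gE sat_fren;
    rewrite (_ : _ \o h = asg (scase f (fun=> a)) \o g) //;
    apply/funext => i /=; rewrite /h; case E: (g i) => [[v|[]]|c] /=;
    by rewrite ?tcons_lift ?tcons0 /= ?E.
(* With neither variables nor parameters at hand, every position names the quantified variable. *)
exists 0, (ex 0 (fren phi (fun=> ord0))), (@noord _).
split=> [[]//|f].
rewrite exE /=; split=> -[a H]; exists a; move: H; rewrite gE sat_fren;
  rewrite (_ : _ \o (fun=> ord0) = asg (scase f (fun=> a)) \o g) //;
  apply/funext => i /=; rewrite tcons0; case E: (proj (g i)) => [w|];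
  by [case: h0; exists w; apply: okg E | move: E; case: (g i) => [[]|]].
Qed.

Lemma def_ex A V n (X : set (V + 'I_n -> C)) : definable A X ->
  definable A [set f : V -> C | exists x, X (scase f x)].
Proof.
elim: n X => [|n IH] X dX.
  apply: def_ext (@def_ren A _ V X (fun w => match w with inl v => v | inr i => noord V i end) dX) => f.
  have E x : scase f x = f \o (fun w => match w with inl v => v | inr i => noord V i end).
    by apply/funext => -[v|[]].
  by split=> [h|[x]]; [exists (@noord C); rewrite E|rewrite E].
pose h (w : V + 'I_n.+1) : (V + 'I_n) + unit :=
  match w with inl v => inl (inl v)
  | inr i => if unlift ord0 i is Some j then inl (inr j) else inr tt end.
have E f a (x : 'I_n -> C) :
    scase (scase f x) (fun=> a) \o h = scase f (tcons a x).
  by apply/funext => -[v|i] //=; rewrite /tcons; case: unlift.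
apply: def_ext (IH _ (def_ex1 (def_ren h dX))) => f /=; split.
  by move=> [x [a]]; rewrite E => H; exists (tcons a x).
by move=> [x H]; exists (x \o lift ord0), (x ord0); rewrite E tcons_eta.
Qed.

Lemma def_consistent A V n m (phi : formula L (n + m)) N (h : 'I_N -> 'I_m -> V) :
  definable A [set f : V -> C | exists x, forall l, sat phi (tcat x (f \o h l))].
Proof.
apply: def_ext (def_ex (def_all (fun l => def_sat A phi (tcat inr (inl \o h l))))) => f.
by split=> -[x xs]; exists x => l; have := xs l; rewrite /= tcat_comp.
Qed.

Lemma def_pholds A n (P : pformula C n) : pover A P ->
  definable A [set x | pholds P x].
Proof.
move=> hP; exists (n + pnum P), (pbody P), (tcat inl (inr \o pars P)).
split=> [i c|f].
  by rewrite /tcat; case: fintype.split => j //= [<-]; apply: hP.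
by rewrite tcat_comp.
Qed.

Lemma pform_def A n (X : set ('I_n -> C)) : definable A X ->
  exists P : pformula C n, pover A P /\ forall x, pholds P x <-> X x.
Proof.
move=> [N [phi [g [gA gE]]]].
(* The parameter tuple has one slot per position of [phi], including positions that hold variables;
   [a0] fills those. If [A] is empty the tuple has to be empty. *)
have [[a0 Aa0]|A0] := pselect (A !=set0).
  pose h i : 'I_(n + N) := if g i is inl j then lshift N j else rshift n i.
  exists (PFormula (fren phi h) (fun i => if g i is inr c then c else a0)).
  split=> [i /=|x]; first by case E : (g i) => [j|c] //; apply: gA E.
  rewrite gE /pholds /= sat_fren (_ : _ \o h = asg x \o g) //.
  apply/funext => i /=; rewrite /h; case E : (g i) => [j|c].
    by rewrite tcat_lshift.
  by rewrite tcat_rshift E.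
have gl i : exists j, g i = inl j.
  by case E : (g i) => [j|c]; [exists j|case: A0; exists c; apply: gA E].
have [h hE] := choice gl.
exists (@PFormula _ C n 0 (fren phi (lshift 0 \o h)) (@noord _)).
split=> [[]//|x]; rewrite gE /pholds /= sat_fren (_ : _ \o _ = asg x \o g) //.
by apply/funext => i /=; rewrite hE tcat_lshift.
Qed.

Definition eqtp A V (x y : V -> C) := forall X, definable A X -> X x -> X y.

Lemma eqtp_iff A V (x y : V -> C) X : eqtp A x y -> definable A X -> X x <-> X y.
Proof.
move=> xy dX; split; first exact: xy.
by move=> Xy; apply: contrapT => nX; apply: (xy _ (def_not dX)).
Qed.

Lemma eqtp_sym A V (x y : V -> C) : eqtp A x y -> eqtp A y x.
Proof. by move=> xy X dX; apply: (eqtp_iff xy dX).2. Qed.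

Lemma eqtp_trans A V (x y z : V -> C) : eqtp A x y -> eqtp A y z -> eqtp A x z.
Proof. by move=> xy yz X dX /(xy _ dX); apply: yz. Qed.

Lemma eqtp_sub A B V (x y : V -> C) : A `<=` B -> eqtp B x y -> eqtp A x y.
Proof. by move=> AB xy X /(def_sub AB); apply: xy. Qed.

Lemma eqtp_ren A V W (h : W -> V) (x y : V -> C) :
  eqtp A x y -> eqtp A (x \o h) (y \o h).
Proof. by move=> xy X dX; apply: (xy _ (def_ren h dX)). Qed.

Lemma realizes_tp A n (x y : 'I_n -> C) : realizes y (tp x A) <-> eqtp A x y.
Proof.
split=> [H X /pform_def [P [PA PX]] /PX Px|H P [PA Px]].
  by apply/PX/H.
exact: (H _ (def_pholds PA) Px).
Qed.

Lemma tp_eqtp A n (x y : 'I_n -> C) : tp x A = tp y A <-> eqtp A x y.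
Proof.
split=> [E|E]; first by apply/realizes_tp => P; rewrite E => -[].
by apply/seteqP; split=> P [PA Px]; split=> //;
  apply/(eqtp_iff E (def_pholds PA)).
Qed.

(** Turning the parameters from [x] into variables reduces types over [A] and [x] to types of longer
    tuples over [A]. *)
Lemma def_absorb A n (x : 'I_n -> C) V (X : set (V -> C)) :
  definable (A `|` range x) X ->
  exists Y : set ('I_n + V -> C), definable A Y /\
    forall f, X f <-> Y (scase x f).
Proof.
move=> [N [phi [g [gA gE]]]].
have /choice [h hE] : forall i, exists w : ('I_n + V) + C,
    (forall c, w = inr c -> A c) /\ forall f, asg f (g i) = asg (scase x f) w.
  move=> i; case E : (g i) => [v|c]; first by exists (inl (inr v)).
  have [Ac|[j _ xc]] := gA _ _ E; first by exists (inr c); split=> // d [<-].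
  by exists (inl (inl j)); split=> // f; rewrite /= xc.
exists [set f : 'I_n + V -> C | sat phi (asg f \o h)]; split.
  by exists N, phi, h; split=> // i c; apply: (hE i).1.
move=> f; rewrite gE /= (_ : asg f \o g = asg (scase x f) \o h) //.
by apply/funext => i /=; apply: (hE i).2.
Qed.

Lemma eqtp_absorb A n (x : 'I_n -> C) V (y z : V -> C) :
  eqtp (A `|` range x) y z <-> eqtp A (scase x y) (scase x z).
Proof.
split=> H X dX.
  move=> Xy; apply: (H [set f | X (scase x f)]) => //.
  pose h (w : 'I_n + V) : V + C :=
    match w with inl i => inr (x i) | inr v => inl v end.
  apply: def_ext (@def_subst A (A `|` range x) _ _ X h _ _ dX) => [f|c|w c].
  - by rewrite /= (_ : asg f \o h = scase x f) //; apply/funext => -[].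
  - by left.
  - by case: w => [i|v] //= [<-]; right; exists i.
have [Y [dY YE]] := def_absorb dX.
by rewrite !YE; apply: H.
Qed.

End Definability.

(** * Compactness and homogeneity *)

Lemma finite_set_enum T (q : set T) : finite_set q ->
  exists N (u : 'I_N -> T), forall x, q x <-> exists i, u i = x.
Proof.
move=> /finite_set_leP [N /card_le_embeds [f fi]].
have [[x0 qx0]|q0] := pselect (q !=set0); last first.
  by exists 0, (@noord T) => x; split=> [qx|[[]//]]; case: q0; exists x.
have /choice [u uE] : forall i : 'I_N, exists x, q x /\
    forall x' (h : q x'), sval (f (exist _ x' h)) = i -> x = x'.
  move=> i; have [[x [h E]]|ni] :=
      pselect (exists x (h : q x), sval (f (exist _ x h)) = i).
    exists x; split=> // x' h' E'.
    by have /sval_inj/fi [] := etrans E (esym E').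
  by exists x0; split=> // x' h' E; case: ni; exists x', h'.
exists N, u => x; split=> [qx|[i <-]]; last exact: (uE i).1.
have iN : sval (f (exist _ x qx)) < N by case: (f _).
by exists (Ordinal iN); apply: ((uE (Ordinal iN)).2 _ qx).
Qed.

Lemma embeds_range T V (A : set T) (x : V -> T) :
  embeds {c | (A `|` range x) c} (V + {c | A c}).
Proof.
have /choice [h hE] : forall c : {c | (A `|` range x) c}, exists w : V + {c | A c},
    scase x sval w = sval c.
  move=> [c h] /=; have [a|n] := pselect (A c); first by exists (inr (exist _ c a)).
  by have [//|[v _ E]] := h; exists (inl v).
by exists h => c d E; apply: sval_inj; rewrite -!hE E.
Qed.

Section Automorphisms.
Variables (L : language) (C : structure L).

Lemma teval_aut (g : C -> C) n (v : 'I_n -> C) t :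
  automorphism g -> g (teval v t) = teval (g \o v) t.
Proof.
move=> [_ gf _]; elim: t => //= f ts IH.
by rewrite gf; congr finterp; apply/funext => i /=.
Qed.

Lemma sat_aut (g : C -> C) n (phi : formula L n) (v : 'I_n -> C) :
  automorphism g -> sat phi v <-> sat phi (g \o v).
Proof.
move=> gA; have [[h hg gh] gf gr] := gA.
elim: phi v => {n} [n|n t u|n r ts|n p IHp q IHq|n p IH] v /=.
- by [].
- rewrite -!teval_aut //; split=> [->//|]; exact: can_inj hg _ _.
- rewrite gr (_ : _ \o _ = fun i => teval (g \o v) (ts i)) //.
  by apply/funext => i /=; rewrite teval_aut.
- by rewrite IHp IHq.
- split=> H a; first by rewrite -(gh a) -tcons_comp -IH.
  by rewrite IH tcons_comp.
Qed.

Lemma asg_aut (g : C -> C) V (A : set C) (x : V -> C) n (w : 'I_n -> V + C) :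
  (forall c, A c -> g c = c) -> (forall i c, w i = inr c -> A c) ->
  g \o (asg x \o w) = asg (g \o x) \o w.
Proof.
move=> gA wA; apply/funext => i /=.
by case E : (w i) => [v|c] //=; apply/gA/(wA _ _ E).
Qed.

Lemma eqtp_aut (g : C -> C) (A : set C) V (x : V -> C) :
  automorphism g -> (forall c, A c -> g c = c) -> eqtp A x (g \o x).
Proof.
move=> ga gA X [n [phi [w [wA wE]]]].
by rewrite !wE -(asg_aut x gA wA) -sat_aut.
Qed.

Lemma aut_inv (g : C -> C) : automorphism g ->
  exists h, [/\ automorphism h, cancel g h & cancel h g].
Proof.
move=> [[h hg gh] gf gr]; exists h; split=> //; split; first by exists g.
- move=> f a; apply: (can_inj hg); rewrite gh gf; congr finterp.
  by apply/funext => i /=; rewrite gh.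
- move=> r a; rewrite (gr r (h \o a)) (_ : g \o (h \o a) = a) //.
  by apply/funext => i /=; rewrite gh.
Qed.

End Automorphisms.

Section Monster.
Variables (K : Type) (L : language) (C : structure L).
Hypothesis Ksat : saturated K C.

Section Compactness.
Variables (A : set C) (V : Type) (F : set (set (V -> C))).
Hypothesis AVsmall : smallT K (V + {c | A c}).
Hypothesis FF : ProperFilter F.

Let good (G : set (V * C)) := forall X, definable A X -> F X ->
  exists f, X f /\ forall v c, G (v, c) -> f v = c.

Let good_fun G v c c' : good G -> G (v, c) -> G (v, c') -> c = c'.
Proof.
move=> /(_ _ (def_top A V) filterT) [f [_ h]] /h <- /h; exact.
Qed.

Let good_max : exists G, good G /\ forall H, G `<=` H -> good H -> H `<=` G.
Proof.
have [H HP Htot|G [cG Gmax]] := @Zorn_bigcup _ good; last first.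
  exists G; split=> // H GH gH; apply: contrapT => HG.
  by apply: (Gmax H).
set U := \bigcup_(X in H) X.
have Ufun v c c' : U (v, c) -> U (v, c') -> c = c'.
  move=> [G1 F1 h1] [G2 F2 h2]; have [s|s] := Htot _ _ F1 F2.
  - by apply: good_fun (HP _ F2) (s _ h1) h2.
  - by apply: good_fun (HP _ F1) h1 (s _ h2).
move=> X dX FX; have [[G0 HG0]|H0] := pselect (H !=set0); last first.
  have [f Xf] := filter_ex FX.
  by exists f; split=> // v c [G HG]; case: H0; exists G.
have [n [phi [g [gA gE]]]] := dX.
(* A definable set depends on finitely many variables, so a single member of the chain already fixes
   all of them that the union fixes. *)
have [G1 HG1 G1E] : exists2 G1, H G1 &
    forall i v c, i \in enum 'I_n -> g i = inl v -> U (v, c) -> G1 (v, c).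
  elim: (enum 'I_n) => [|i s [G1 HG1 G1E]]; first by exists G0.
  have [[v [c [gi [G2 HG2 Gvc]]]]|hi] :=
      pselect (exists v c, g i = inl v /\ U (v, c)); last first.
    exists G1 => // j v c; rewrite inE => /orP [/eqP -> gi Uv|]; last exact: G1E.
    by case: hi; exists v, c.
  have Gi w d : g i = inl w -> U (w, d) -> G2 (w, d).
    rewrite gi => -[<-] Uvd; rewrite (_ : d = c) //.
    by apply: Ufun Uvd _; exists G2.
  have [s12|s12] := Htot _ _ HG1 HG2.
  - exists G2 => // j w d; rewrite inE => /orP [/eqP ->|js gj Uj]; first exact: Gi.
    by apply/s12/(G1E j).
  - exists G1 => // j w d; rewrite inE => /orP [/eqP -> gj Uj|]; last exact: G1E.
    by apply/s12/Gi.
have [f0 [Xf0 f0E]] := HP _ HG1 X dX FX.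
have /choice [f fE] : forall v, exists c, (forall d, U (v, d) -> c = d) /\
    ((forall d, ~ U (v, d)) -> c = f0 v).
  move=> v; have [[c Uc]|nU] := pselect (exists c, U (v, c)).
    by exists c; split=> [d|/(_ c)//]; apply: Ufun.
  by exists (f0 v); split=> // d Ud; case: nU; exists d.
exists f; split; last by move=> v c; apply: (fE v).1.
rewrite gE (_ : _ \o _ = asg f0 \o g) -?gE //; apply/funext => i /=.
case E : (g i) => [v|c] //=; have [[c Uc]|nU] := pselect (exists c, U (v, c)).
  rewrite ((fE v).1 c) //; apply/esym/f0E/(G1E i) => //; exact: mem_enum.
by apply: (fE v).2 => d Ud; apply: nU; exists d.
Qed.

(* A maximal partial assignment compatible with all definable sets in F is total by
   saturation. *)
Theorem compactness : exists f : V -> C, forall X, definable A X -> F X -> X f.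
Proof.
have [G [gG Gmax]] := good_max.
suff /choice [f fG] : forall v, exists c, G (v, c).
  exists f => X dX FX; have [f' [Xf' f'E]] := gG _ dX FX.
  by rewrite (_ : f = f') //; apply/funext => v; rewrite (f'E v (f v)).
move=> v; apply: contrapT => nG.
pose A' := A `|` [set c | exists w, G (w, c)].
have A'small : small K A'.
  apply/smallP; apply: smallT_embeds AVsmall.
  have /choice [h hE] : forall c : {c | A' c}, exists w : V + {c | A c},
      match w with inl w => G (w, sval c) | inr d => sval d = sval c end.
    move=> [c [Ac|[w Gw]]]; first by exists (inr (exist _ c Ac)).
    by exists (inl w).
  exists h => c d E; apply: sval_inj.
  have := hE c; have := hE d; rewrite -E; case: (h c) => [w|a].
    by move=> h1 h2; apply: good_fun h2 h1.
  by move=> <-.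
(* The type of a possible value at [v]: everything that some set of the filter forces on it, given
   the values fixed by [G]. Finite satisfiability is compatibility of [G] with finite
   intersections. *)
pose p : set (pformula C 1) := [set P | pover A' P /\ exists X, [/\ definable A X,
  F X & forall f, X f -> (forall w c, G (w, c) -> f w = c) -> pholds P (fun=> f v)]].
have pcons : consistent p.
  move=> q /finite_set_enum [N [u uE]] qp.
  have /choice [X XE] : forall i, exists X, [/\ definable A X, F X &
      forall f, X f -> (forall w c, G (w, c) -> f w = c) -> pholds (u i) (fun=> f v)].
    by move=> i; have /qp [] : q (u i) by apply/uE; exists i.
  have [f [Xf fG]] := gG [set f | forall i, X i f]
    (def_all (fun i => let: And3 h _ _ := XE i in h))
    (filter_forall _ (fun i => let: And3 _ h _ := XE i in h)).
  exists (fun=> f v); split=> // P /uE [i <-].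
  by have [_ _] := XE i; apply.
have [x xp] := Ksat A'small (fun (P : pformula C 1) (h : p P) => proj1 h) pcons.
pose c := x ord0.
apply: (nG); exists c; apply: (Gmax (G `|` [set (v, c)])); first by move=> z; left.
  2: by right.
move=> X dX FX; have [n [phi [g [gA gE]]]] := dX.
(* To see that [c] is admissible for [X], the variables of [phi] are replaced by a finite tuple [z].
   The constraints say that [z] comes from an assignment extending [G] with the realized element at
   [v]. *)
pose T (i : 'I_n) : set ('I_1 + 'I_n -> C) := [set z |
  [/\ forall a, g i = inr a -> z (inr i) = a,
      g i = inl v -> z (inr i) = z (inl ord0),
      forall w d, g i = inl w -> G (w, d) -> z (inr i) = d &
      forall j, g i = g j -> z (inr i) = z (inr j)]].
have dT i : definable A' (T i).
  have eqv V' (u w : V') : definable A' [set f : V' -> C | f u = f w].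
    exact: (@def_eq _ _ A' V' (inl u) (inl w)).
  have eqc V' (u : V') a : A' a -> definable A' [set f : V' -> C | f u = a].
    by move=> A'a; apply: (@def_eq _ _ A' V' (inl u) (inr a)) => // d [<-].
  have d1 : definable A'
      [set z : 'I_1 + 'I_n -> C | forall a, g i = inr a -> z (inr i) = a].
    case E : (g i) => [w|a].
      by apply: def_ext (def_top _ _) => z; split.
    apply: def_ext (eqc _ (inr i) a _) => [z|]; last by left; apply: gA E.
    by split=> [h b [<-]|]; [|apply].
  have d2 : definable A'
      [set z : 'I_1 + 'I_n -> C | g i = inl v -> z (inr i) = z (inl ord0)].
    exact: (def_imp (def_const _ _ _) (eqv _ _ _)).
  have d3 : definable A' [set z : 'I_1 + 'I_n -> C |
      forall w d, g i = inl w -> G (w, d) -> z (inr i) = d].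
    have [[w [d [gi Gd]]]|nw] := pselect (exists w d, g i = inl w /\ G (w, d)).
      apply: def_ext (eqc _ (inr i) d _) => [z|]; last by right; exists w.
      split=> [h w' d'|h]; last exact: h gi Gd.
      by rewrite gi => -[<-] Gd'; rewrite -(good_fun gG Gd Gd').
    apply: def_ext (def_top _ _) => z; split=> // _ w d gi Gd.
    by case: nw; exists w, d.
  have d4 := def_all (fun j => def_imp (def_const A' _ (g i = g j))
    (eqv ('I_1 + 'I_n)%type (inr i) (inr j))).
  apply: def_ext (def_and (def_and d1 d2) (def_and d3 d4)) => z.
  by split=> [[[? ?] [? ?]]|[? ? ? ?]].
have dZ := def_ex (def_and (@def_sat _ _ A' _ _ phi inr) (def_all dT)).
have [P [A'P PE]] := pform_def dZ.
have /xp : p P.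
  split=> //; exists X; split=> // f Xf fG; apply/PE; exists (asg f \o g).
  split; first by move/gE: Xf.
  move=> i; split=> /=.
  - by move=> a ->.
  - by move=> ->.
  - by move=> w d -> /=; apply: fG.
  - by move=> j ->.
move/PE => [z [/= satz Tz]].
have [f0 [_ f0G]] := gG _ (def_top A V) filterT.
have /choice [f fE] : forall w, exists d, [/\
    forall i, g i = inl w -> d = z i, w = v -> d = c & forall e, G (w, e) -> d = e].
  move=> w; have [[i gi]|ni] := pselect (exists i, g i = inl w).
    exists (z i); have [_ h2 h3 h4] := Tz i; split.
    - by move=> j gj; apply: h4; rewrite gj.
    - by move=> E; apply: h2; rewrite gi E.
    - by move=> e; apply: h3.
  have [wv|nw] := pselect (w = v).
    exists c; split=> // [i gi|e Ge]; first by case: ni; exists i.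
    by case: nG; exists e; rewrite -wv.
  exists (f0 w); split=> // [i gi|e]; first by case: ni; exists i.
  by move=> Ge; apply: f0G.
exists f; split.
  have fz : asg f \o g = z.
    apply/funext => i /=; case E : (g i) => [w|a] /=.
      by have [/(_ _ E)] := fE w.
    by have [/(_ _ E)] := Tz i.
  by rewrite gE fz; exact: satz.
move=> w d [Gd|[-> ->]]; first by have [_ _] := fE w; apply.
by have [_ + _] := fE v; apply.
Qed.

End Compactness.

Lemma compact_base A V I (D : set I) (B : I -> set (V -> C)) :
  smallT K (V + {c | A c}) -> (exists i, D i) ->
  (forall i j, D i -> D j -> exists2 k, D k & B k `<=` B i `&` B j) ->
  (forall i, D i -> B i !=set0) ->
  exists f, forall X, definable A X -> forall i, D i -> B i `<=` X -> X f.
Proof.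
move=> sA D0 DI B0.
have [f fE] := compactness sA
  (filter_from_proper (filter_from_filter D0 DI) B0).
by exists f => X dX i Di BX; apply: fE => //; exists i.
Qed.

(** Were no formula of tp(c/A) contained in [X], compactness applied to the sets [Y] minus [X] would
    give a realization of the type outside [X]. *)
Lemma compact_eqtp A D V (c : V -> C) X :
  smallT K (V + {d | D d}) -> A `<=` D -> definable D X ->
  (forall x, eqtp A c x -> X x) ->
  exists Y, [/\ definable A Y, Y c & Y `<=` X].
Proof.
move=> sD AD dX cX; apply: contrapT => nY.
have [|Y Z [dY Yc] [dZ Zc]|Y [dY Yc]|f fF] := @compact_base D V _
  [set Y | definable A Y /\ Y c] (fun Y => Y `\` X) sD.
- by exists setT; split=> //; apply: def_top.
- exists (Y `&` Z); first by split=> //; apply: def_and.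
  by move=> x [[Yx Zx] Xx].
- apply: contrapT => YX; apply: nY; exists Y; split=> // x Yx.
  by apply: contrapT => Xx; apply: YX; exists x; split.
apply: (fF (~` X) (def_not dX) setT); first by split=> //; apply: def_top.
  by move=> x [].
by apply: cX => Y dY Yc; apply: (fF Y (def_sub AD dY) Y).
Qed.

Hypothesis Khom : strongly_homogeneous K C.

Lemma eqtp_conj A V (x y : V -> C) : smallT K (V + {c | A c}) -> eqtp A x y ->
  exists g, [/\ automorphism g, forall c, A c -> g c = c & g \o x = y].
Proof.
move=> sA xy.
pose ok (w : V + C) := forall c, w = inr c -> A c.
(* Equalities among coordinates and parameters belong to the type, so sending [x] to [y] over [A] is
   a well-defined partial map. *)
have okE w w' : ok w -> ok w' -> asg x w = asg x w' -> asg y w = asg y w'.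
  by move=> ow ow'; apply: (xy _ (def_eq ow ow')).
have okx c : (A `|` range x) c -> exists2 w, ok w & asg x w = c.
  move=> [Ac|[v _ <-]]; first by exists (inr c) => // d [<-].
  by exists (inl v).
have /choice [f fE] : forall c, exists d, forall w, ok w -> asg x w = c -> asg y w = d.
  move=> c; have [/okx [w ow wc]|nc] := pselect ((A `|` range x) c).
    by exists (asg y w) => w' ow' w'c; apply: okE => //; rewrite wc.
  exists c => -[v|d] ow E; case: nc; first by right; exists v.
  by left; rewrite -E; apply: ow.
have [||g [ga gE]] := Khom (A := A `|` range x) (f := f).
- by apply/smallP; apply: smallT_embeds sA; apply: embeds_range.
- move=> n phi a aA.
  have /choice [w wE] : forall i, exists u, ok u /\ asg x u = a i.
    by move=> i; have [u] := okx _ (aA i); exists u.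
  have -> : a = asg x \o w by apply/funext => i /=; rewrite (wE i).2.
  have -> : f \o (asg x \o w) = asg y \o w.
    by apply/funext => i /=; apply/esym/fE; first exact: (wE i).1.
  apply: (eqtp_iff (X := [set z : V -> C | sat phi (asg z \o w)]) xy).
  by exists n, phi, w; split=> // i; apply: (wE i).1.
exists g; split=> // [c Ac|].
  rewrite gE; last by left.
  by apply/esym/(fE c (inr c)) => // d [<-].
apply/funext => v /=; rewrite gE; last by right; exists v.
exact/esym/(fE _ (inl v)).
Qed.

End Monster.

(** * Tree rank *)

Lemma infinite_pigeonhole (T : finType) (p : nat -> T) :
  exists c (h : nat -> nat), {homo h : i j / i < j} /\ forall i, p (h i) = c.
Proof.
have [c cE] : exists c, forall N, exists i, N < i /\ p i = c.
  apply: contrapT => H.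
  have /choice [N NE] : forall c, exists N, forall i, N < i -> p i <> c.
    move=> c; apply: contrapT => Hc; apply: H; exists c => N.
    apply: contrapT => HN; apply: Hc; exists N => i Ni pi.
    by apply: HN; exists i.
  pose i := (\max_c N c).+1.
  by apply: (NE (p i) i) => //; rewrite /i ltnS; apply: leq_bigmax.
have [g gE] := choice cE.
(* The iteration starts at exponent 1 because 0 itself need not have colour [c]. *)
exists c, (fun i => iter i.+1 g 0); split=> [|i]; last exact: (gE _).2.
apply: homo_ltn => [? ? ?|i]; first exact: ltn_trans.
exact: (gE _).1.
Qed.

Section Rank.
Variables (L : language) (C : structure L) (n : nat).

(* A formula phi(x, y) together with a k for which instances are tested for
   k-inconsistency. *)
Definition entry := {m : nat & (formula L (n + m) * nat)%type}.

Definition inst (d : entry) (a : 'I_(tag d) -> C) : set ('I_n -> C) :=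
  [set x | sat (tagged d).1 (tcat x a)].

(* Since X need not be definable, the rank of a union can be treated by the
   pigeonhole principle. *)
Fixpoint rank_ge (D : set entry) k (X : set ('I_n -> C)) : Prop :=
  if k is k'.+1 then
    exists d, D d /\ exists a : nat -> 'I_(tag d) -> C,
      k_inconsistent (tagged d).1 (tagged d).2 a /\
      forall i, rank_ge D k' (X `&` inst (a i))
  else X !=set0.

Implicit Types (D : set entry) (X Y : set ('I_n -> C)).

Lemma rank_sub D D' k X Y : D `<=` D' -> X `<=` Y ->
  rank_ge D k X -> rank_ge D' k Y.
Proof.
move=> DD; elim: k X Y => [|k IH] X Y XY /=; first by move=> [x /XY]; exists x.
move=> [d [Dd [a [ak ar]]]]; exists d; split; first exact: DD.
by exists a; split=> // i; apply: IH (ar i) => x [/XY].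
Qed.

Lemma rank_nonempty D k X : rank_ge D k X -> X !=set0.
Proof.
elim: k X => [//|k IH] X /= [d [_ [a [_ /(_ 0) /IH [x [Xx _]]]]]].
by exists x.
Qed.

Lemma k_inconsistent_sub m (phi : formula L (n + m)) k (a : nat -> 'I_m -> C)
  (h : nat -> nat) : {homo h : i j / i < j} ->
  k_inconsistent phi k a -> k_inconsistent phi k (a \o h).
Proof. by move=> hh ak s sh; apply: (ak (h \o s)) => i j /sh /hh. Qed.

Lemma k_inconsistent_leq m (phi : formula L (n + m)) k k' (a : nat -> 'I_m -> C) :
  k <= k' -> k_inconsistent phi k a -> k_inconsistent phi k' a.
Proof.
move=> kk ak s sh [x xs]; apply: (ak (s \o widen_ord kk)) => [i j ij|].
  exact: sh.
by exists x => l; apply: xs.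
Qed.

Lemma rank_setU D k X Y : rank_ge D k (X `|` Y) -> rank_ge D k X \/ rank_ge D k Y.
Proof.
elim: k X Y => [|k IH] X Y /=; first by move=> [x [h|h]]; [left|right]; exists x.
move=> [d [Dd [a [ak ar]]]].
have [c [h [hh hc]]] := infinite_pigeonhole
  (fun i => `[< rank_ge D k (X `&` inst (a i)) >]).
case: c hc => hc; [left|right]; exists d; split=> //; exists (a \o h);
  (split=> [|i]; first exact: k_inconsistent_sub).
  by apply/asboolP; rewrite hc.
have := ar (h i); rewrite setIUl => /IH [|//].
by move/asboolP; rewrite hc.
Qed.

Lemma rank_bigU D k N (Z : 'I_N -> set ('I_n -> C)) X :
  X `<=` [set x | exists l, Z l x] -> rank_ge D k X ->
  exists l, rank_ge D k (X `&` Z l).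
Proof.
elim: N X Z => [|N IH] X Z XZ rX.
  by have [x /XZ [[]]] := rank_nonempty rX.
have /rank_setU [h|] : rank_ge D k ((X `&` Z ord0) `|`
    (X `&` [set x | exists l, Z (lift ord0 l) x])).
  apply: rank_sub rX => // x Xx; have [l] := XZ _ Xx.
  by case: (unliftP ord0 l) => [j|] -> Zx; [right; split=> //; exists j|left].
  by exists ord0.
move=> /(IH _ (Z \o lift ord0)) [x [_ [l Zl]]|l h]; first by exists l.
by exists (lift ord0 l); apply: rank_sub h => // x [[]].
Qed.

Lemma rank_aut D k X (g : C -> C) : automorphism g ->
  rank_ge D k X -> rank_ge D k [set x | X (g \o x)].
Proof.
move=> ga; have [h [ha gh hg]] := aut_inv ga.
have ghx m (x : 'I_m -> C) : g \o (h \o x) = x by apply/funext => i /=; rewrite hg.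
have instE d (a : 'I_(tag d) -> C) x : inst (h \o a) x <-> inst a (g \o x).
  by rewrite /inst /= (sat_aut _ _ ga) tcat_comp ghx.
elim: k X => [|k IH] X /=; first by move=> [x Xx]; exists (h \o x); rewrite /= ghx.
move=> [d [Dd [a [ak ar]]]]; exists d; split=> //.
exists (fun i => h \o a i); split=> [s sh [x xs]|i].
  by apply: (ak s sh); exists (g \o x) => l; apply/instE/xs.
by apply: rank_sub (IH _ (ar i)) => // x [Xx /instE].
Qed.

(** If the top entry is in [D1], either some branch keeps the full [D2]-rank, or every branch has
    [D1]-rank one lower than required and the top entry restores that unit. The other case is
    symmetric. *)
Lemma rank_split D1 D2 k1 k2 X : rank_ge (D1 `|` D2) (k1 + k2) X ->
  rank_ge D1 k1 X \/ rank_ge D2 k2 X.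
Proof.
move E : (k1 + k2) => k; elim: k k1 k2 X E => [|k IH] [|k1] [|k2] X E //= rX;
  try (by left); try (by left; apply: (@rank_nonempty (D1 `|` D2) k.+1));
  try (by right; apply: (@rank_nonempty (D1 `|` D2) k.+1)).
have [d [Dd [a [ak ar]]]] := rX; case: Dd => Dd.
- have [[i ri]|ni] := pselect (exists i, rank_ge D2 k2.+1 (X `&` inst (a i))).
    by right; apply: rank_sub ri => // x [].
  left; exists d; split=> //; exists a; split=> // i.
  have [|//|ri] := IH k1 k2.+1 _ _ (ar i); first by move: E => [].
  by case: ni; exists i.
- have [[i ri]|ni] := pselect (exists i, rank_ge D1 k1.+1 (X `&` inst (a i))).
    by left; apply: rank_sub ri => // x [].
  right; exists d; split=> //; exists a; split=> // i.
  have [|ri|//] := IH k1.+1 k2 _ _ (ar i); first by move: E; rewrite addnS => -[].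
  by case: ni; exists i.
Qed.

Definition bounded D := exists k, ~ rank_ge D k (@setT ('I_n -> C)).

Lemma bounded_setU D1 D2 : bounded D1 -> bounded D2 -> bounded (D1 `|` D2).
Proof.
by move=> [k1 h1] [k2 h2]; exists (k1 + k2) => /rank_split [].
Qed.

Lemma bounded_range : (forall d, bounded [set d]) ->
  forall N (d : 'I_N -> entry), bounded (range d).
Proof.
move=> H; elim=> [|N IH] d; first by exists 1 => -[d' [[i _ _] _]]; case: i.
have [k h] := bounded_setU (H (d ord0)) (IH (d \o lift ord0)).
exists k => r; apply: h; apply: rank_sub r => // _ [l _ <-].
by case: (unliftP ord0 l) => [j|] ->; [right; exists j|left].
Qed.

Lemma rank_tree d k X : rank_ge [set d] k X ->
  exists a : seq nat -> 'I_(tag d) -> C,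
  (forall s, size s < k ->
    k_inconsistent (tagged d).1 (tagged d).2 (fun i => a (rcons s i))) /\
  forall s, size s <= k -> exists2 x, X x &
    forall j, j < size s -> inst (a (take j.+1 s)) x.
Proof.
have [c0] := dom_inhabited C.
elim: k X => [|k IH] X /= rX.
  exists (fun _ _ => c0); split=> // -[|//] _.
  by have [x Xx] := rX; exists x.
have [d' [-> [a [ak ar]]]] := rX.
have /choice [t tE] := fun i => IH _ (ar i).
(* The root of the subtree [t i] carries a filler; it is replaced by the instance [a i] leading to
   that subtree. *)
pose u i s := if s is [::] then a i else t i s.
have uE i s j : u i (rcons s j) = t i (rcons s j) by case: s.
exists (fun s => if s is i :: s' then u i s' else a 0); split.
  move=> [|i s] /=; first by [].
  rewrite ltnS => /((tE i).1); suff -> : (fun j => u i (rcons s j)) =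
    (fun j => t i (rcons s j)) by [].
  by apply/funext => j; rewrite uE.
move=> [|i s] /=; first by have [x [Xx _]] := rank_nonempty (ar 0); exists x.
rewrite ltnS => /((tE i).2) [x [Xx ax] xs]; exists x => // -[|j] /=.
  by rewrite take0.
rewrite ltnS => js; have := xs j js.
by case: s js {xs} => [|i' s'].
Qed.

Lemma take_mkseq (eta : nat -> nat) j N : j <= N ->
  take j (mkseq eta N) = mkseq eta j.
Proof. by move=> jN; rewrite /mkseq -map_take take_iota (minn_idPl jN). Qed.

End Rank.

(** * Dividing and forking *)

Section Forking.
Variables (K : Type) (L : language) (C : structure L).
Hypothesis Knat : smallT K nat.
Hypothesis Ksat : saturated K C.
Hypothesis Khom : strongly_homogeneous K C.

Implicit Types (A B : set C).

Definition smallC A := smallT K {c | A c}.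

Lemma small_vars V A : embeds V nat -> smallC A -> smallT K (V + {c | A c}).
Proof.
move=> Vn sA; apply: smallT_embeds (smallT_sum_nat Knat sA Vn).
by exists (fun w => match w with inl v => inr v | inr c => inl c end) =>
  -[v|c] [v'|c'] // [->].
Qed.

Lemma small_range A V (x : V -> C) : embeds V nat -> smallC A ->
  smallC (A `|` range x).
Proof.
by move=> Vn sA; apply: smallT_embeds (embeds_range A x) _; apply: small_vars.
Qed.

Lemma small_sub A B : A `<=` B -> smallC B -> smallC A.
Proof.
move=> AB; apply: smallT_embeds.
exists (fun c => exist B (sval c) (AB _ (proj2_sig c))) => c d [].
exact: sval_inj.
Qed.

Lemma embeds_ord n : embeds 'I_n nat.
Proof. exact: embeds_countType. Qed.

(** The bound k is fixed by the entry, whereas [formula_divides] quantifies over it: a rank bound is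
    available only once finitely many pairs of formula and k are chosen. *)
Definition divs n A (d : entry L n) (a : 'I_(tag d) -> C) :=
  exists b : nat -> 'I_(tag d) -> C, (forall i, eqtp A a (b i)) /\
    k_inconsistent (tagged d).1 (tagged d).2 b.

Lemma divs_sub n A B (d : entry L n) (a : 'I_(tag d) -> C) :
  A `<=` B -> divs B a -> divs A a.
Proof.
move=> AB [b [bB bk]]; exists b; split=> // i; exact: eqtp_sub AB (bB i).
Qed.

Definition pentry n (P : pformula C n) k : entry L n :=
  existT _ (pnum P) (pbody P, k).

Lemma formula_dividesP n (P : pformula C n) A :
  formula_divides P A <-> exists k, @divs n A (pentry P k) (pars P).
Proof.
split=> -[k [b [bA bk]]]; exists k, b; split=> // i.
  by apply: eqtp_sym; apply/tp_eqtp; apply: bA.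
by apply/tp_eqtp; apply: eqtp_sym; apply: bA.
Qed.

Lemma divs_aut n A (d : entry L n) (a : 'I_(tag d) -> C) g :
  automorphism g -> (forall c, A c -> g c = c) -> divs A a -> divs A (g \o a).
Proof.
move=> ga gA [b [bA bk]]; exists b; split=> // i.
by apply: eqtp_trans (bA i); apply: eqtp_sym; apply: eqtp_aut.
Qed.

Lemma divs_conj n A (d : entry L n) (a : 'I_(tag d) -> C) : smallC A ->
  divs A a -> exists g : nat -> C -> C,
    (forall i, automorphism (g i) /\ forall c, A c -> g i c = c) /\
    k_inconsistent (tagged d).1 (tagged d).2 (fun i => g i \o a).
Proof.
move=> sA [b [bA bk]].
have /choice [g gE] := fun i => eqtp_conj Khom (small_vars (embeds_ord _) sA) (bA i).
exists g; split=> [i|]; first by have [] := gE i.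
by rewrite (_ : (fun i => _) = b) //; apply/funext => i; have [] := gE i.
Qed.

(** The two formulas may have unrelated parameter tuples. A witness for [Q] made of automorphic
    images is therefore carried over to [P] by the same automorphisms. *)
Lemma formula_divides_sub n (P Q : pformula C n) A : smallC A ->
  (forall x, pholds P x -> pholds Q x) -> formula_divides Q A -> formula_divides P A.
Proof.
move=> sA PQ /formula_dividesP [k /(divs_conj sA) [g [gA gk]]].
apply/formula_dividesP; exists k, (fun i => g i \o pars P); split=> [i|s sh].
  by have [ga gfix] := gA i; apply: eqtp_aut.
move=> [x xs]; apply: (gk s sh); exists x => l.
have [ga _] := gA (s l); have [h [ha gh hg]] := aut_inv ga.
have E : x = g (s l) \o (h \o x) by apply/funext => i /=; rewrite hg.
have := xs l; rewrite /= {1}E -tcat_comp -sat_aut // => /PQ.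
by rewrite /pholds (sat_aut _ _ ga) tcat_comp -E.
Qed.

Definition forkset n A (X : set ('I_n -> C)) := exists N (Q : 'I_N -> pformula C n),
  (forall l, formula_divides (Q l) A) /\ X `<=` [set x | exists l, pholds (Q l) x].

Lemma forks_tp n (c : 'I_n -> C) A B : forks (tp c B) A <-> forkset A (eqtp B c).
Proof.
split=> -[N [Q [QA Qx]]]; exists N, Q; split=> // x.
  by move/realizes_tp/Qx.
by move/realizes_tp/(Qx x).
Qed.

Lemma divides_tp n (c : 'I_n -> C) A B : divides (tp c B) A <->
  exists Q, formula_divides Q A /\ eqtp B c `<=` [set x | pholds Q x].
Proof.
split=> -[Q [QA Qx]]; exists Q; split=> // x.
  by move/realizes_tp/Qx.
by move/realizes_tp/(Qx x).
Qed.

Lemma divides_forks n (p : set (pformula C n)) A : divides p A -> forks p A.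
Proof.
move=> [Q [QA Qx]]; exists 1, (fun=> Q); split=> // x /Qx h; by exists ord0.
Qed.

Lemma forkset_sub n A (X Y : set ('I_n -> C)) : X `<=` Y -> forkset A Y -> forkset A X.
Proof. by move=> XY [N [Q [QA YQ]]]; exists N, Q; split=> // x /XY /YQ. Qed.

Lemma forkset_setU n A (X Y : set ('I_n -> C)) :
  forkset A X -> forkset A Y -> forkset A (X `|` Y).
Proof.
move=> [N [Q [QA XQ]]] [M [R [RA YR]]]; exists (N + M), (tcat Q R); split.
  by move=> l; rewrite /tcat; case: fintype.split.
move=> x [/XQ [l Ql]|/YR [l Rl]].
  by exists (lshift M l); rewrite tcat_lshift.
by exists (rshift N l); rewrite tcat_rshift.
Qed.

Lemma forkset0 n A : forkset A (@set0 ('I_n -> C)).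
Proof. by exists 0, (@noord _); split=> [[]//|x []]. Qed.

Lemma common_pars n N (Q : 'I_N -> pformula C n) :
  exists m (e : 'I_m -> C) (h : forall l, 'I_(pnum (Q l)) -> 'I_m),
    forall l, pars (Q l) = e \o h l.
Proof.
pose W := {l : 'I_N & 'I_(pnum (Q l))}.
exists #|{: W}|, (fun i => pars (Q (tag (enum_val i))) (tagged (enum_val i))),
  (fun l j => enum_rank (Tagged (fun l => 'I_(pnum (Q l))) j)) => l.
by apply/funext => j /=; rewrite enum_rankK.
Qed.

Lemma eqtp_cover n N (Q : 'I_N -> pformula C n) (c : 'I_n -> C) B : smallC B ->
  eqtp B c `<=` [set x | exists l, pholds (Q l) x] ->
  exists Y, [/\ definable B Y, Y c & Y `<=` [set x | exists l, pholds (Q l) x]].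
Proof.
move=> sB cQ; have [m [e [h eh]]] := common_pars Q.
apply: (compact_eqtp Ksat (D := B `|` range e)) => //.
- exact: small_vars (embeds_ord _) (small_range _ (embeds_ord _) sB).
- apply: def_exI => l; apply: def_pholds => i; right.
  by exists (h l i) => //; rewrite eh.
Qed.

Lemma forks_formula n (c : 'I_n -> C) A B : smallC B -> forkset A (eqtp B c) ->
  exists Y, [/\ definable B Y, Y c & forkset A Y].
Proof.
move=> sB [N [Q [QA cQ]]]; have [Y [dY Yc YQ]] := eqtp_cover sB cQ.
by exists Y; split=> //; exists N, Q.
Qed.

Lemma divides_formula n (c : 'I_n -> C) A B : smallC A -> smallC B ->
  divides (tp c B) A ->
  exists P, [/\ pover B P, pholds P c & formula_divides P A].
Proof.
move=> sA sB /divides_tp [Q [QA cQ]].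
have [x /cQ Qx|Y [dY Yc YQ]] := @eqtp_cover n 1 (fun=> Q) c B sB.
  by exists ord0.
have [P [PB PY]] := pform_def dY; exists P; split=> //; first exact/PY.
by apply: formula_divides_sub QA => // x /PY /YQ [].
Qed.

Lemma divides_of_formula n (c : 'I_n -> C) A B P : pover B P -> pholds P c ->
  formula_divides P A -> divides (tp c B) A.
Proof. by move=> PB Pc PA; exists P; split=> // x; apply. Qed.

Lemma divides_sub n (c : 'I_n -> C) A A' B B' : A `<=` A' -> B `<=` B' ->
  divides (tp c B) A' -> divides (tp c B') A.
Proof.
move=> AA BB /divides_tp [Q [/formula_dividesP [k QA] cQ]]; apply/divides_tp.
exists Q; split; first by apply/formula_dividesP; exists k; apply: divs_sub QA.
by move=> x /(eqtp_sub BB) /cQ.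
Qed.

(* The formulas over B' that fork over A form an ideal containing no formula of
   tp(e/B), so their negations are consistent with tp(e/B). *)
Lemma nonforking_extension n (e : 'I_n -> C) A B B' : B `<=` B' -> smallC B' ->
  ~ forkset A (eqtp B e) -> exists x, eqtp B e x /\ ~ forkset A (eqtp B' x).
Proof.
move=> BB sB' nf.
have [||[Y Z] [/= dY [Ye [dZ fZ]]]|x xE] := @compact_base K L C Ksat B' 'I_n _
  [set p : set ('I_n -> C) * set ('I_n -> C) |
    definable B p.1 /\ p.1 e /\ definable B' p.2 /\ forkset A p.2]
  (fun p => p.1 `\` p.2) (small_vars (embeds_ord _) sB').
- exists (setT, set0); split=> /=; first exact: def_top.
  by split=> //; split; [apply: def_bot|apply: forkset0].
- move=> [Y Z] [Y' Z'] [/= dY [Ye [dZ fZ]]] [/= dY' [Ye' [dZ' fZ']]].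
  exists (Y `&` Y', Z `|` Z') => /=.
    split; first exact: def_and.
    by split=> //; split; [apply: def_or|apply: forkset_setU].
  by move=> x [[Yx Yx'] Zx]; split; split=> // h; apply: Zx; [left|right].
- apply: contrapT => YZ; apply: nf; apply: forkset_sub fZ => x /(_ Y dY Ye) Yx.
  by apply: contrapT => Zx; apply: YZ; exists x; split.
exists x; split=> [Y dY Ye|].
  apply: (xE Y (def_sub BB dY) (Y, set0)); last by move=> z [].
  by split=> //=; split=> //; split; [apply: def_bot|apply: forkset0].
move=> /(forks_formula sB') [Y [dY Yx fY]].
suff : (~` Y) x by [].
apply: (xE _ (def_not dY) (setT, Y)); last by move=> z [].
by split=> //=; apply: def_top.
Qed.

(** The automorphisms over [A] that conjugate the dividing instance preserve [Y], so all the
    conjugate pieces of [Y] have the same rank. *)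
Lemma rank_drop n A (D : set (entry L n)) k Y d (a : 'I_(tag d) -> C) :
  smallC A -> (forall x y, eqtp A x y -> Y x -> Y y) -> D d -> divs A a ->
  rank_ge D k (Y `&` inst a) -> rank_ge D k.+1 Y.
Proof.
move=> sA Yinv Dd /(divs_conj sA) [g [gA gk]] r /=.
exists d; split=> //; exists (fun i => g i \o a); split=> // i.
have [ga gfix] := gA i; have [h [ha gh hg]] := aut_inv ga.
apply: rank_sub (rank_aut ha r) => // x [Yx ax].
have E : x = g i \o (h \o x) by apply/funext => j /=; rewrite hg.
split; first by rewrite E; apply: Yinv Yx; apply: eqtp_aut.
by rewrite E /inst /= -tcat_comp -sat_aut.
Qed.

(* Let (b_i) witness dividing.  For theta in tp(d/Ba) the formulas theta(x, b_i)
   are not N-inconsistent for any N, so by compactness there is such a sequence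
   (b'_i) with tp(d/Ba) true of all (d', b'_i) for one d', which can be moved to
   d.  This is where indiscernible sequences are avoided. *)
Lemma divs_extend n m B (p : entry L n) (a : 'I_(tag p) -> C) (d : 'I_m -> C) :
  smallC B -> ~ divides (tp d (B `|` range a)) B ->
  divs B a -> divs (B `|` range d) a.
Proof.
move=> sB nd dB; have [g [gB gk]] := divs_conj sB dB.
pose V := ('I_m + nat * 'I_(tag p))%type.
pose b' (f : V -> C) i := fun j => f (inr (i, j)).
have Vn : embeds V nat by apply: embeds_countType.
pose kinc (f : V -> C) N := forall s : 'I_(tagged p).2 -> nat,
  (forall i j : 'I_(tagged p).2, i < j -> s i < s j) -> (forall i, s i < N) ->
  ~ exists x, forall l, inst (b' f (s l)) x.
have [|||f fE] := @compact_base K L C Ksat B V _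
  [set q : set ('I_m + 'I_(tag p) -> C) * nat | definable B q.1 /\ q.1 (scase d a)]
  (fun q => [set f : V -> C | (forall i, i < q.2 -> q.1 (scase (f \o inl) (b' f i))) /\
                     kinc f q.2]) (small_vars Vn sB).
- by exists (setT, 0); split=> //; apply: def_top.
- move=> [T N] [T' N'] [/= dT Ta] [/= dT' Ta'].
  exists (T `&` T', maxn N N'); first by split=> //; apply: def_and.
  move=> f [/= fT fk]; split; split=> [i iN|s sh sN].
  + by apply: (fT i _).1; rewrite leq_max iN.
  + by apply: fk => // i; rewrite leq_max sN.
  + by apply: (fT i _).2; rewrite leq_max iN orbT.
  + by apply: fk => // i; rewrite leq_max sN orbT.
(* Since T(x, a) does not divide over [B], some [N] of its conjugates have a common solution. This
   solution and the matching conjugates of [a] give the required finite configuration. *)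
- move=> [T N] [/= dT Ta].
  have [P [PB PE]] : exists P : pformula C m, pover (B `|` range a) P /\
      forall x, pholds P x <-> T (scase x a).
    apply: (@pform_def L C (B `|` range a) m (fun x => T (scase x a))).
    pose h (w : 'I_m + 'I_(tag p)) : 'I_m + C :=
      match w with inl i => inl i | inr j => inr (a j) end.
    apply: def_ext (@def_subst L C B (B `|` range a) _ _ T h _ _ dT) => [x|c|w c].
    - by rewrite /= (_ : asg x \o h = scase x a) //; apply/funext => -[].
    - by left.
    - by case: w => [i|j] //= [<-]; right; exists j.
  have : ~ k_inconsistent (pbody P) N (fun i => g i \o pars P).
    move=> Pk; apply: nd; apply: (divides_of_formula PB); first exact/PE.
    apply/formula_dividesP; exists N, (fun i => g i \o pars P); split=> // i.
    by have [ga gfix] := gB i; apply: eqtp_aut.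
  move=> /existsNP [s /not_implyP [sh /contrapT [x xs]]].
  (* The value 0 beyond [N] is a filler: only the first [N] terms are constrained. *)
  pose t i := if insub i is Some j then s j else 0.
  have tE (j : 'I_N) : t j = s j by rewrite /t valK.
  exists (scase x (fun w => g (t w.1) (a w.2))); split=> [i iN|r rh rN] /=.
    have ti : t i = s (Ordinal iN) := tE (Ordinal iN).
    have [ga gfix] := gB (s (Ordinal iN)).
    have [h [ha gh hg]] := aut_inv ga.
    have E : x = g (s (Ordinal iN)) \o (h \o x).
      by apply/funext => j /=; rewrite hg.
    have := xs (Ordinal iN); rewrite /= {1}E -tcat_comp -sat_aut // => /PE.
    move=> /(eqtp_aut ga gfix dT); congr T.
    by apply/funext => -[j|j] /=; rewrite ?hg // /b' /= ti.
  move=> [y ys]; apply: (gk (fun l => t (r l))); last by exists y => l; apply: ys.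
  move=> i j ij; rewrite (tE (Ordinal (rN i))) (tE (Ordinal (rN j))).
  by apply: sh; apply: rh.
pose d' : 'I_m -> C := f \o inl.
have fT i : eqtp B (scase d a) (scase d' (b' f i)).
  move=> T dT Ta; pose h (w : 'I_m + 'I_(tag p)) : V :=
    match w with inl j => inl j | inr j => inr (i, j) end.
  have E (z : V -> C) : z \o h = scase (z \o inl) (b' z i).
    by apply/funext => -[].
  rewrite /d' -E; apply: (fE _ (def_ren h dT) (T, i.+1)) => // z [zT _] /=.
  by rewrite E; apply: zT.
have fk : k_inconsistent (tagged p).1 (tagged p).2 (b' f).
  move=> s sh.
  pose X := [set z : V -> C | exists x, forall l, inst (b' z (s l)) x].
  have dX : definable B X.
    exact: (def_consistent B (tagged p).1 (fun l j => inr (s l, j))).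
  apply: (fE (~` X) (def_not dX) (setT, (\max_l s l).+1)).
    by split=> //; apply: def_top.
  by move=> z [_ /(_ s sh)] /= h; apply: h => i; rewrite ltnS; apply: leq_bigmax.
have dd' : eqtp B d' d := eqtp_sym (eqtp_ren (h := inl) (fT 0)).
have [k [ka kfix kd]] := eqtp_conj Khom (small_vars (embeds_ord _) sB) dd'.
exists (fun i => k \o b' f i); split=> [i|s sh].
  apply/eqtp_absorb; apply: eqtp_trans (fT i) _.
  rewrite (_ : scase d _ = k \o scase d' (b' f i)); first exact: eqtp_aut.
  by apply/funext => -[j|j] //=; rewrite -kd.
have [h [ha kh hk]] := aut_inv ka.
move=> [x xs]; apply: (fk s sh); exists (h \o x) => l.
by rewrite (sat_aut _ _ ka) tcat_comp
  (_ : k \o (h \o x) = x) //; apply/funext => j /=; rewrite hk.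
Qed.

Definition before (A : set C) m (d : nat -> 'I_m -> C) i :=
  A `|` [set c | exists2 j, j < i & range (d j) c].

(* The i-th condition, with parameters from A and d_i, divides over A and the
   later terms d_{i+1}, ..., d_{k-1}; so it costs one unit of rank. *)
Lemma independent_rank n m A (D : set (entry L n)) (d : nat -> 'I_m -> C) k
    (w : nat -> {p : entry L n & 'I_(tag p) -> C}) x :
  smallC A ->
  (forall i, i < k -> ~ divides (tp (d i) (before A d i)) A) ->
  (forall i, i < k -> [/\ D (tag (w i)), divs A (tagged (w i)),
     range (tagged (w i)) `<=` A `|` range (d i) & inst (tagged (w i)) x]) ->
  rank_ge D k (@setT ('I_n -> C)).
Proof.
move=> sA nd wE.
pose T j k' := A `|` [set c | exists2 i, j <= i < k' & range (d i) c].
have sT j k' : smallC (T j k').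
  apply: small_sub (small_range (fun w : nat * 'I_m => d w.1 w.2)
    (embeds_countType _) sA) => c [Ac|[i _ [l _ <-]]]; first by left.
  by right; exists (i, l).
(* The term [d k'] is added to the base by [divs_extend]: its type over the earlier terms, among
   which lie the parameters of [w j], does not divide over [A]. *)
have divT j k' : j < k' -> k' <= k -> divs (T j.+1 k') (tagged (w j)).
  elim: k' => // k' IH; rewrite ltnS leq_eqVlt => /orP [/eqP <-|jk] kk.
    have [_ h _ _] := wE _ kk; apply: divs_sub h => c [//|[i]].
    by case/andP => /leq_trans h /h; rewrite ltnn.
  have := divs_extend (sT j.+1 k') _ (IH jk (ltnW kk)).
  move=> /(_ _ (d k')) h; apply: divs_sub (h _).
    move=> c [Ac|[i]]; first by left; left.
    rewrite ltnS [i <= k']leq_eqVlt => /andP [ji /orP [/eqP ->|ik]] ci.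
      by right.
    by left; right; exists i => //; rewrite ji.
  move=> dv; apply: (nd _ kk); apply: divides_sub dv; first by move=> c; left.
  move=> c [[Ac|[i /andP [_ ik] ci]]|].
  - by left.
  - by right; exists i.
  - have [_ _ wr _] := wE _ (ltn_trans jk kk).
    by move=> /wr [|cj]; [left|right; exists j].
(* Conditions are released in increasing order. [Y 0] contains [x], [Y k] is everything, and passing
   from [Y j] to [Y j.+1] drops condition [j], which divides over a set under whose automorphisms
   [Y j.+1] is invariant. *)
pose Y j := [set y | forall i, j <= i < k -> inst (tagged (w i)) y].
suff : forall j, j <= k -> rank_ge D j (Y j).
  by move=> /(_ k (leqnn k)); apply: rank_sub.
elim=> [|j IH] jk.
  by exists x => i /= ik; have [_ _ _] := wE _ ik.
have [Dj _ _ _] := wE _ jk.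
apply: (rank_drop (sT j.+1 k) _ Dj (divT _ _ jk (leqnn k))).
  move=> y z yz Yy i ji; have /andP [_ ik] := ji; have [_ _ wr _] := wE _ ik.
  apply: (eqtp_iff (X := inst (tagged (w i))) yz _).1 (Yy i ji).
  apply: (@def_pholds L C _ n (PFormula (tagged (tag (w i))).1 (tagged (w i)))).
  move=> l /=; have [//|Al|dl] := wr (tagged (w i) l); first by left.
  by right; exists i.
apply: rank_sub (IH (ltnW jk)) => // y Yy; split=> [i /andP [ji ik]|].
  by apply: Yy; rewrite (ltnW ji).
by apply: Yy; rewrite leqnn.
Qed.

(** [B] may exceed the base [A]: the proof of symmetry needs realizations of a type over [A] and [b]
    that are independent over [A]. *)
Lemma independent_sequence m A B (X : set ('I_m -> C)) : A `<=` B -> smallC B ->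
  (forall B', smallC B' -> B `<=` B' -> exists x, X x /\ ~ forkset A (eqtp B' x)) ->
  exists d : nat -> 'I_m -> C,
    forall i, X (d i) /\ ~ divides (tp (d i) (before B d i)) A.
Proof.
move=> AB sB ext.
have /choice [g gE] : forall B', exists x, smallC B' -> B `<=` B' ->
    X x /\ ~ forkset A (eqtp B' x).
  move=> B'; have [[s h]|n] := pselect (smallC B' /\ B `<=` B').
    by have [x] := ext _ s h; exists x.
  have [c0] := dom_inhabited C.
  by exists (fun=> c0) => s h; case: n.
pose Bs i := iter i (fun B' => B' `|` range (g B')) B.
have BsE i : smallC (Bs i) /\ B `<=` Bs i.
  elim: i => [|i [s h]] /=; first by split=> // c.
  split; last by move=> c /h; left.
  exact: small_range (embeds_ord _) s.
exists (fun i => g (Bs i)) => i; have [s h] := BsE i; have [Xi nf] := gE _ s h.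
split=> // dv; apply: nf; apply/forks_tp/divides_forks; apply: divides_sub dv => //.
move=> c [/h//|[j ji cj]]; move: ji cj; elim: i {s h Xi} => // i IH.
by rewrite ltnS leq_eqVlt => /orP [/eqP ->|ji cj]; [right|left; apply: IH].
Qed.

End Forking.

(** * Simple theories *)

Section Simple.
Variables (K : Type) (L : language) (C : structure L).
Hypothesis Knat : smallT K nat.
Hypothesis Ksat : saturated K C.
Hypothesis Khom : strongly_homogeneous K C.

Implicit Types (A B : set C).

Lemma small0 : smallC K (@set0 C).
Proof.
by apply: smallT_embeds Knat; exists (fun=> 0) => -[c []].
Qed.

(** Unbounded rank gives trees of every finite height, which compactness glues into one of infinite
    height with the tree property. *)
Lemma simple_bounded : simple_theory C ->
  forall n (d : entry L n), bounded C [set d].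
Proof.
move=> simple n d; apply: contrapT => nb.
have rk k : rank_ge [set d] k (@setT ('I_n -> C)).
  by apply: contrapT => h; apply: nb; exists k.
pose V := (seq nat * 'I_(tag d))%type.
pose node (f : V -> C) s : 'I_(tag d) -> C := fun j => f (s, j).
have [|i j _ _|k _|f fE] := @compact_base K L C Ksat set0 V _ [set: nat]
  (fun k => [set f : V -> C | (forall s, size s < k ->
     k_inconsistent (tagged d).1 (tagged d).2 (fun i => node f (rcons s i))) /\
   forall s, size s <= k -> exists x : 'I_n -> C,
     forall j : 'I_(size s), inst (node f (take j.+1 s)) x])
  (small_vars Knat (embeds_countType _) small0).
- by exists 0.
- exists (maxn i j) => // f [fk fb]; split; split=> s sh.
  + by apply: fk; rewrite leq_max sh.
  + by apply: fb; rewrite leq_max sh.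
  + by apply: fk; rewrite leq_max sh orbT.
  + by apply: fb; rewrite leq_max sh orbT.
- have [a [ak ab]] := rank_tree (rk k).
  exists (fun w => a w.1 w.2); split=> // s /ab [x _ xs].
  by exists x => j; apply: xs.
have fk s : k_inconsistent (tagged d).1 (tagged d).2 (fun i => node f (rcons s i)).
  move=> r rh.
  pose X := [set z : V -> C | exists x, forall l, inst (node z (rcons s (r l))) x].
  have dX : definable set0 X.
    exact: (def_consistent set0 (tagged d).1 (fun l j => (rcons s (r l), j))).
  apply: (fE (~` X) (def_not dX) (size s).+1) => // z [zk _] zX.
  exact: (zk s (ltnSn _) r rh).
have fb s : exists x : 'I_n -> C, forall j : 'I_(size s), inst (node f (take j.+1 s)) x.
  apply: (fE [set z : V -> C | exists x : 'I_n -> C,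
      forall j : 'I_(size s), inst (node z (take j.+1 s)) x] _ (size s)) => //.
    exact: (def_consistent set0 (tagged d).1
      (fun (l : 'I_(size s)) j => (take l.+1 s, j))).
  by move=> z [_ /(_ s (leqnn _))].
(* The tree property demands a bound of at least 2, and inconsistency persists when the bound
   grows. *)
apply: (simple _ _ (tagged d).1); exists (maxn 2 (tagged d).2), (node f); split.
- by rewrite leq_maxl.
- by move=> s; apply: k_inconsistent_leq (fk s); rewrite leq_maxr.
move=> eta q /finite_set_enum [N [u uE]] qs.
have /choice [j jE] : forall i, exists j,
    0 < j /\ u i = PFormula (tagged d).1 (node f (mkseq eta j)).
  move=> i; have /qs [j j0 uj] : q (u i) by apply/uE; exists i.
  by exists j.
have [x xs] := fb (mkseq eta (\max_i j i)).
exists x; split=> // P /uE [i <-]; have [j0 ->] := jE i.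
have ji : (j i).-1 < size (mkseq eta (\max_i j i)).
  by rewrite size_mkseq prednK //; apply: leq_bigmax.
have := xs (Ordinal ji); rewrite /= prednK // take_mkseq //; exact: leq_bigmax.
Qed.

Hypothesis simple : simple_theory C.

(** If [X] has rank at least [r], so does its part in one of the finitely many dividing formulas; by
    invariance [X] then has rank at least [r.+1]. Starting from nonemptiness, this exceeds every
    bound. *)
Lemma not_forkset_invariant n A (X : set ('I_n -> C)) : smallC K A ->
  (forall x y, eqtp A x y -> X x -> X y) -> X !=set0 -> ~ forkset A X.
Proof.
move=> sA Xinv X0 [N [Q [/= QA XQ]]].
have /choice [k kE] := fun l => (formula_dividesP (Q l) A).1 (QA l).
have [r nr] := bounded_range (simple_bounded simple (n := n))
  (fun l => pentry (Q l) (k l)).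
apply: nr; pose D := range (fun l => pentry (Q l) (k l)).
suff h : rank_ge D r X by apply: rank_sub h.
elim: r => [//|r IH].
have [l rl] := rank_bigU XQ IH.
have Dl : D (pentry (Q l) (k l)) by exists l.
exact (rank_drop Knat Khom sA Xinv Dl (kE l) rl).
Qed.

Lemma forks_divides n m A (b : 'I_m -> C) (c : 'I_n -> C) : smallC K A ->
  forks (tp c (A `|` range b)) A -> divides (tp c (A `|` range b)) A.
Proof.
move=> sA /forks_tp fk; apply: contrapT => nd.
have sAb : smallC K (A `|` range b) := small_range Knat b (embeds_ord _) sA.
have [N [Q [QA cQ]]] := fk.
have [Y [dY Yc YQ]] := eqtp_cover Knat Ksat sAb cQ.
have [P [PB PY]] := pform_def dY.
have [me [e [h eh]]] := common_pars Q.
have /choice [k kE] := fun l => (formula_dividesP (Q l) A).1 (QA l).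
have [r nr] := bounded_range (simple_bounded simple (n := n))
  (fun l => pentry (Q l) (k l)).
apply: nr.
(* [e] is included so that conjugating [b] to a term of the independent sequence also puts the
   parameters of every [Q l] into that term. *)
pose be := tcat b e.
have nbe : ~ forkset A (eqtp A be).
  apply: not_forkset_invariant => //; last by exists be.
  by move=> x y xy bx; apply: eqtp_trans xy.
have [|B' sB' AB'|d dE] := @independent_sequence K L C Knat _ A A (eqtp A be) _ sA.
- by [].
- exact (nonforking_extension Knat Ksat AB' sB' nbe).
have /choice [g gE] := fun i =>
  eqtp_conj Khom (small_vars Knat (embeds_ord _) sA) (dE i).1.
(* As [P] does not divide, [r] of its conjugates along the sequence share a solution [x]. Each of
   them implies a conjugate of some [Q l], so [x] meets [r] dividing conditions and contradicts the
   rank bound [r]. *)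
have : ~ k_inconsistent (pbody P) r (fun i => g i \o pars P).
  move=> Pk; apply: nd; apply: (divides_of_formula PB); first exact/PY.
  apply/formula_dividesP; exists r, (fun i => g i \o pars P); split=> // i.
  by have [ga gfix _] := gE i; apply: eqtp_aut.
move=> /existsNP [s /not_implyP [sh /contrapT [x xs]]].
pose t i := if insub i is Some j then s j else 0.
have tE (j : 'I_r) : t j = s j by rewrite /t valK.
have /choice [w wE] : forall i, exists w : {p : entry L n & 'I_(tag p) -> C}, i < r ->
    [/\ range (fun l => pentry (Q l) (k l)) (tag w), divs A (tagged w),
     range (tagged w) `<=` A `|` range (d (t i)) & inst (tagged w) x].
  move=> i; have [ir|ir] := boolP (i < r); last first.
    (* Indices from [r] on are unconstrained, so a formula that is never true serves as filler. *)
    have [c0] := dom_inhabited C.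
    by exists (existT _ (existT _ 0 (Bot L _, 0)) (fun=> c0)).
  have := xs (Ordinal ir); rewrite -(tE (Ordinal ir)) /=.
  have [ga gfix gd] := gE (t i); have [gi [gia ggi gig]] := aut_inv ga.
  have E : x = g (t i) \o (gi \o x) by apply/funext => j /=; rewrite gig.
  rewrite {1}E -tcat_comp -sat_aut // => /PY /YQ [l Ql].
  exists (existT _ (pentry (Q l) (k l)) (g (t i) \o pars (Q l))) => _; split=> /=.
  - by exists l.
  - exact: divs_aut.
  - move=> _ [j _ <-]; right; exists (rshift m (h l j)) => //.
    by rewrite -gd /= /be tcat_rshift eh.
  - by rewrite /inst /= E -tcat_comp -sat_aut.
apply: (independent_rank Knat Ksat Khom sA _ (wE)) => i ir.
have [_ nd'] := dE (t i); apply: contra_not nd'; apply: divides_sub => //.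
move=> c' [Ac|[j ji cj]]; [by left|right; exists (t j) => //].
by rewrite (tE (Ordinal ir)) (tE (Ordinal (ltn_trans ji ir))); apply: sh.
Qed.

(** Along a sequence of realizations of tp(c/Ab) independent over [A], conjugating [c] while fixing
    [A] and [b] gives arbitrarily many dividing conditions, all satisfied by the one point [b]. This
    is more than the rank allows. *)
Lemma nonforking_sym n m A (b : 'I_m -> C) (c : 'I_n -> C) : smallC K A ->
  ~ forks (tp c (A `|` range b)) A -> ~ divides (tp b (A `|` range c)) A.
Proof.
move=> sA nf dv.
have sAb : smallC K (A `|` range b) := small_range Knat b (embeds_ord _) sA.
have sAc : smallC K (A `|` range c) := small_range Knat c (embeds_ord _) sA.
have [P [PB Pb /formula_dividesP [k dP]]] := divides_formula Knat Ksat Khom sA sAc dv.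
have [r nr] := simple_bounded simple (pentry P k); apply: nr.
have nfc : ~ forkset A (eqtp (A `|` range b) c) by move=> h; apply: nf; apply/forks_tp.
have [|B' sB' AB'|d dE] := @independent_sequence K L C Knat _ A (A `|` range b)
  (eqtp (A `|` range b) c) _ sAb.
- by move=> z; left.
- exact (nonforking_extension Knat Ksat AB' sB' nfc).
have /choice [g gE] := fun i =>
  eqtp_conj Khom (small_vars Knat (embeds_ord _) sAb) (dE i).1.
have gA i z : A z -> g i z = z by move=> Az; have [_ -> //] := gE i; left.
apply: (@independent_rank K L C Knat Ksat Khom m n A _ d r
  (fun i => existT _ (pentry P k) (g i \o pars P)) b sA) => i ir.
  have [_ nd] := dE i; apply: contra_not nd; apply: divides_sub => //.
  by move=> z [Az|zj]; [left; left|right].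
have [ga gfix gc] := gE i; split=> //=.
- by apply: divs_aut => // z; apply: gA.
- move=> _ [j _ <-] /=; have [Aj|[l _ <-]] := PB j; first by left; rewrite gA.
  by right; exists l => //; rewrite -gc.
- rewrite /inst /= (_ : b = g i \o b); first by rewrite -tcat_comp -sat_aut.
  by apply/funext => j /=; rewrite gfix //; right; exists j.
Qed.

Lemma simple_dfc : dual_finite_character K C.
Proof.
move=> A m n b c /smallP sA fk.
have dcb := forks_divides sA fk.
have dbc : divides (tp b (A `|` range c)) A.
  apply: (forks_divides sA); apply: contrapT => nf.
  exact: (nonforking_sym sA nf).
have [P [PB Pb PA]] := divides_formula Knat Ksat Khom sA
  (small_range Knat c (embeds_ord _) sA) dbc.
(* The parameters from [c] become variables, which yields a formula over [A] in both tuples. *)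
have [Y [dY YE]] := def_absorb (def_pholds PB).
pose h (w : 'I_n + 'I_m) : 'I_(n + m) :=
  match w with inl i => lshift m i | inr j => rshift n j end.
have hE b' : tcat c b' \o h = scase c b'.
  by apply/funext => -[i|j] /=; rewrite ?tcat_lshift ?tcat_rshift.
have [phi [phiA phiE]] := pform_def (def_ren h dY).
exists phi; split=> // [|b']; first by apply/phiE; rewrite /= hE; apply/YE.
move/phiE; rewrite /= hE => /YE Pb'.
apply: contrapT => nf; apply: (nonforking_sym sA nf).
exact: divides_of_formula PB Pb' PA.
Qed.

End Simple.

(** * From dual finite character to its weak form *)

Section FinitelySatisfiable.
Variables (K : Type) (L : language) (C : structure L).
Hypothesis Knat : smallT K nat.
Hypothesis Ksat : saturated K C.

(** A point of [A] that satisfies one formula dividing over [A] satisfies all its conjugates over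
    [A], against k-inconsistency. *)
Lemma finitely_satisfiable_nonforking n (c : 'I_n -> C) (A B : set C) :
  smallC K B -> finitely_satisfiable (tp c B) A -> ~ forks (tp c B) A.
Proof.
move=> sB fs /forks_tp [N [Q [QA cQ]]].
have [Y [dY Yc YQ]] := eqtp_cover Knat Ksat sB cQ.
have [P [PB PY]] := pform_def dY.
have [|x [xA xP]] := fs [set P] (finite_set1 P).
  by move=> _ ->; split=> //; apply/PY.
have /PY/YQ [l Ql] := xP P erefl.
have /formula_dividesP [k [b [bA bk]]] := QA l.
apply: (bk (fun i => val i)) => //; exists x => i.
pose h : 'I_(n + pnum (Q l)) -> 'I_(pnum (Q l)) + C := tcat (inr \o x) inl.
have hE (z : 'I_(pnum (Q l)) -> C) : asg z \o h = tcat x z by rewrite tcat_comp.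
have : definable A [set z : 'I_(pnum (Q l)) -> C | sat (pbody (Q l)) (tcat x z)].
  exists _, (pbody (Q l)), h; split=> [j a|f]; last by rewrite hE.
  by rewrite /h /tcat; case: fintype.split => // j' [<-]; apply: xA.
by move=> /(bA i); apply.
Qed.

Lemma dfc_weak_dfc : dual_finite_character K C -> weak_dual_finite_character K C.
Proof.
move=> dfc M m n b c _ sM dv.
have [phi [phiM phicb phiE]] := dfc M m n b c sM (divides_forks dv).
exists phi; split=> // b' /phiE fk fs.
apply: finitely_satisfiable_nonforking fs fk.
by apply: (small_range Knat _ (embeds_ord _)); apply/smallP.
Qed.

End FinitelySatisfiable.

(** * Skolem hulls and the tree property *)

Section SkolemTerms.
Variables (L : language) (B : Type).

(* Wit phi ts names an element y with phi(y, ts), if there is one. *)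
Inductive skterm : Type :=
| Base of B
| Wit n of formula L n.+1 & ('I_n -> skterm).

Fixpoint skin (P : B -> Prop) (t : skterm) : Prop :=
  match t with
  | Base b => P b
  | Wit n phi ts => forall i, skin P (ts i)
  end.

Lemma skin_sub (P Q : B -> Prop) t : (forall b, P b -> Q b) -> skin P t -> skin Q t.
Proof. by move=> PQ; elim: t => [b|n phi ts IH] //= h; auto. Qed.

Let S := (fsym L + rsym L + nat)%type.
Notation tree := (GenTree.tree S).

Fixpoint tcode n (t : term L n) : tree :=
  match t with
  | Var i => GenTree.Node 0 [:: GenTree.Leaf (inr (val i))]
  | App f ts => GenTree.Node 1
      (GenTree.Leaf (inl (inl f)) :: [seq tcode (ts i) | i <- enum 'I_(farity f)])
  end.

Lemma tcode_inj n : injective (@tcode n).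
Proof.
elim=> [i|f ts IH] [j|g us] //= [].
  by move/val_inj => ->.
move=> fg; subst g => /eq_in_map E; congr App; apply/funext => i.
by apply: IH; apply: E; rewrite mem_enum.
Qed.

Fixpoint fcode n (phi : formula L n) : tree :=
  match phi with
  | Bot _ => GenTree.Node 0 [::]
  | Eq _ t u => GenTree.Node 1 [:: tcode t; tcode u]
  | Rel _ r ts => GenTree.Node 2
      (GenTree.Leaf (inl (inr r)) :: [seq tcode (ts i) | i <- enum 'I_(rarity r)])
  | Imp _ p q => GenTree.Node 3 [:: fcode p; fcode q]
  | All _ p => GenTree.Node 4 [:: fcode p]
  end.

(** Quantifiers change the scope, so the induction compares formulas of two scopes with a proof that
    these agree. *)
Lemma fcode_inj n : injective (@fcode n).
Proof.
suff H : forall n (phi : formula L n) m (psi : formula L m) (e : n = m),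
    fcode phi = fcode psi -> eq_rect n (formula L) phi m e = psi.
  by move=> phi psi /(H _ _ _ _ erefl).
move=> {}n; elim=> {n} [n|n t u|n r ts|n p IHp q IHq|n p IH] m [{}m|{}m t' u'|{}m r' ts'|{}m p' q'|{}m p'] //= e; subst m => //= -[].
- by move=> /tcode_inj -> /tcode_inj ->.
- move=> rr; subst r' => /eq_in_map E; congr Rel; apply/funext => i.
  by apply: tcode_inj; apply: E; rewrite mem_enum.
- by move=> /(IHp _ _ erefl) /= -> /(IHq _ _ erefl) /= ->.
- by move=> /(IH _ _ erefl) /= ->.
Qed.

Lemma embeds_skterm : embeds B nat -> embeds skterm S.
Proof.
move=> [e ei].
pose code := fix code (t : skterm) : tree :=
  match t with
  (* The arity is stored explicitly, since [fcode] does not record the scope of a formula. *)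
  | Base b => GenTree.Node 0 [:: GenTree.Leaf (inr (e b))]
  | Wit n phi ts => GenTree.Node 1 [:: GenTree.Leaf (inr n), fcode phi
      & [seq code (ts i) | i <- enum 'I_n]]
  end.
have code_inj : injective code.
  elim=> [b|n phi ts IH] [b'|n' phi' ts'] //= [].
    by move/ei => ->.
  move=> E; subst n' => /fcode_inj -> /eq_in_map E; congr Wit.
  by apply/funext => i; apply: IH; apply: E; rewrite mem_enum.
have nS : embeds nat S by exists inr => i j [].
have nnS : embeds nat (nat + S) by exists inl => i j [].
apply: (@embeds_trans _ tree); first by exists code.
apply: (@embeds_trans _ (seq (nat + S))).
  by exists (@GenTree.encode S); apply: pcan_inj (@GenTree.codeK S).
apply: embeds_trans (embeds_words nnS) _.
apply: embeds_trans (embeds_sum_nat nS).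
by exists (fun w => match w with inl i => inr i | inr s => inl s end) =>
  -[i|s] [j|u] // [->].
Qed.

End SkolemTerms.

Arguments Base {L B}.
Arguments Wit {L B n}.

Section TarskiVaught.
Variables (L : language) (C : structure L) (M : set C).

Definition tarski_vaught := forall n (phi : formula L n.+1) (v : 'I_n -> C),
  tuple_in M v -> (exists y, sat phi (tcons y v)) ->
  exists y, M y /\ sat phi (tcons y v).

Hypothesis tv : tarski_vaught.

Lemma tarski_vaught_elementary : elementary_submodel M.
Proof.
have S0 : inhabited {x : C | M x}.
  have [||y [My _]] := tv (phi := Imp (Bot L _) (Bot L _)) (v := @noord C).
  - by case.
  - by have [c] := dom_inhabited C; exists c.
  - by constructor; exists y.
have Scl : fclosed M.
  move=> f a Ma.
  have E y : sat (Eq (Var ord0) (App f (fun i => Var (lift ord0 i)))) (tcons y a) <->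
      y = finterp a.
    by rewrite /= tcons0; split=> ->; congr finterp; apply/funext => i;
      rewrite tcons_lift.
  have [|y [My /E <-//]] := tv (phi := Eq (Var ord0)
    (App f (fun i => Var (lift ord0 i)))) Ma.
  by exists (finterp a); apply/E.
exists S0, Scl => n phi; elim: phi => {n} [n|n t u|n r ts|n p IHp q IHq|n p IH] v.
- by [].
- have tE (t' : term L n) : sval (@teval L (substructure S0 Scl) n v t') =
      teval (fun i => sval (v i)) t'.
    by elim: t' => //= f ts IH; congr finterp; apply/funext.
  by rewrite /= -!tE; split=> [->//|]; apply: sval_inj.
- have tE (t' : term L n) : sval (@teval L (substructure S0 Scl) n v t') =
      teval (fun i => sval (v i)) t'.
    by elim: t' => //= f us IH; congr finterp; apply/funext.
  rewrite /= (_ : (fun i => sval _) = fun i => teval (fun i => sval (v i)) (ts i)) //.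
  by apply/funext.
- by rewrite /= IHp IHq.
- have E a : (fun i => sval (tcons a v i)) = tcons (sval a) (fun i => sval (v i)).
    exact: (tcons_comp sval a v).
  split=> /= H a; last by rewrite IH E.
  apply: contrapT => na.
  have [||y [My ny]] := tv (phi := Imp p (Bot L _)) (v := fun i => sval (v i)).
  + by move=> i; apply: (proj2_sig (v i)).
  + by exists a.
  + by apply: ny; have := H (exist _ y My); rewrite IH E.
Qed.

(** The criterion supplies one coordinate at a time; each coordinate found then becomes a parameter
    from [M]. *)
Lemma tarski_vaught_definable n (X : set ('I_n -> C)) :
  definable M X -> X !=set0 -> exists x, tuple_in M x /\ X x.
Proof.
elim: n X => [|n IH] X dX [x0 Xx0].
  by exists x0; split=> // -[].
pose h (w : 'I_n.+1) : 'I_1 + 'I_n :=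
  if unlift ord0 w is Some j then inr j else inl ord0.
have hE (y : 'I_1 -> C) v : scase y v \o h = tcons (y ord0) v.
  by apply/funext => i; rewrite /h /tcons /=; case: unlift.
have [P [PM PE]] := pform_def (def_ex (def_ren h dX)).
have tE (y : C) : tcat (fun _ : 'I_1 => y) (pars P) = tcons y (pars P).
  apply/funext => i; case: (split_ordP i) => j ->.
    rewrite tcat_lshift (_ : lshift _ j = ord0 :> 'I_(pnum P).+1) ?tcons0 //.
    by apply: val_inj; case: j => -[].
  rewrite tcat_rshift (_ : rshift 1 j = lift ord0 j :> 'I_(pnum P).+1).
    by rewrite tcons_lift.
  exact: val_inj.
have [||y [My yP]] := tv (phi := pbody P) (v := pars P).
- exact: PM.
- exists (x0 ord0); rewrite -tE; apply/PE; exists (x0 \o lift ord0).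
  by rewrite /= hE tcons_eta.
move: yP; rewrite -tE => /PE [v]; rewrite /= hE => Xyv.
pose g (w : 'I_n.+1) : 'I_n + C :=
  if unlift ord0 w is Some j then inl j else inr y.
have gE (z : 'I_n -> C) : asg z \o g = tcons y z.
  by apply/funext => i; rewrite /g /tcons /=; case: unlift.
have dX' : definable M [set z | X (asg z \o g)].
  apply: (@def_subst L C M M) dX => // w c; rewrite /g; case: unlift => // -[<-].
  exact: My.
have [|z [Mz]] := IH _ dX'; first by exists v; rewrite /= gE.
rewrite /= gE => Xz; exists (tcons y z); split=> // i.
by rewrite /tcons; case: unlift.
Qed.

End TarskiVaught.

Section SkolemHull.
Variables (L : language) (C : structure L).

Lemma skolem_functions : exists W : forall n, formula L n.+1 -> ('I_n -> C) -> C,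
  forall n (phi : formula L n.+1) v, (exists y, sat phi (tcons y v)) ->
    sat phi (tcons (W n phi v) v).
Proof.
pose D := {n : nat & (formula L n.+1 * ('I_n -> C))%type}.
have /choice [W WE] : forall d : D, exists w, forall y,
    sat (tagged d).1 (tcons y (tagged d).2) -> sat (tagged d).1 (tcons w (tagged d).2).
  move=> d; have [[y h]|n] := pselect (exists y, sat (tagged d).1 (tcons y (tagged d).2)).
    by exists y.
  by have [c0] := dom_inhabited C; exists c0 => y h; case: n; exists y.
exists (fun n phi v => W (existT _ n (phi, v))) => n phi v [y].
exact: (WE (existT _ n (phi, v))).
Qed.

Fixpoint skeval (W : forall n, formula L n.+1 -> ('I_n -> C) -> C) B (beta : B -> C)
    (t : skterm L B) : C :=
  match t with
  | Base b => beta b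
  | Wit n phi ts => W n phi (fun i => skeval W beta (ts i))
  end.

Lemma skeval_local W B (P : B -> Prop) (beta beta' : B -> C) t :
  (forall b, P b -> beta b = beta' b) -> skin P t ->
  skeval W beta t = skeval W beta' t.
Proof.
move=> E; elim: t => [b|n phi ts IH] /= h; first exact: E.
by congr W; apply/funext => i; apply: IH.
Qed.

(** Closure is a family of first-order conditions on the values of names, not evaluation by fixed
    Skolem functions, so it survives compactness and limits. The map [nm] places the names among
    possibly more variables. *)
Definition skolem_closed V (w : V -> C) B (nm : skterm L B -> V) :=
  forall n (phi : formula L n.+1) ts,
    (exists y, sat phi (tcons y (w \o nm \o ts))) ->
    sat phi (tcons (w (nm (Wit phi ts))) (w \o nm \o ts)).

Lemma def_skolem V B (nm : skterm L B -> V) n (phi : formula L n.+1) ts :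
  definable set0 [set w : V -> C | (exists y, sat phi (tcons y (w \o nm \o ts))) ->
    sat phi (tcons (w (nm (Wit phi ts))) (w \o nm \o ts))].
Proof.
apply: def_imp.
  apply: def_ext (def_ex1 (def_sat set0 phi (tcons (inr tt) (inl \o nm \o ts)))) => w.
  have E y : scase w (fun=> y) \o tcons (inr tt) (inl \o nm \o ts) =
      tcons y (w \o nm \o ts) by rewrite tcons_comp.
  by split=> -[y h]; exists y; move: h; rewrite /mkset E.
apply: def_ext (def_sat set0 phi (tcons (nm (Wit phi ts)) (nm \o ts))) => w.
by rewrite /mkset tcons_comp.
Qed.

End SkolemHull.

Section TreeProperty.
Variables (K : Type) (L : language) (C : structure L).
Hypothesis Ksmall : smallT K (fsym L + rsym L + nat).
Hypothesis Ksat : saturated K C.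

Let Knat : smallT K nat.
Proof. by apply: smallT_embeds Ksmall; exists inr => i j []. Qed.

Variables (n m k : nat) (phi : formula L (n + m)).

(* Base (inl (j, i, l)) names the l-th coordinate of a_{j,i}, where a_{j,0}, a_{j,1}, ...
   are siblings, and Base (inr l) that of c. *)
Definition name := (nat * nat * 'I_m + 'I_n)%type.
Let sk := skterm L name.

Definition entryof (f : sk -> C) j i : 'I_m -> C := fun l => f (Base (inl (j, i, l))).
Definition pointof (f : sk -> C) : 'I_n -> C := fun l => f (Base (inr l)).

Definition below j (b : name) := exists j' l, j' < j /\ b = inl (j', 0, l).

(** Equality of types over the hull of the earlier branch terms is split into single formulas with
    finitely many Skolem terms, so that finitely many tests can be imposed at a time. *)
Definition test := {N : nat & (formula L (m + N) * ('I_N -> sk))%type}.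

Definition passes (q : test) (f : sk -> C) := forall j i,
  (forall l, skin (below j) ((tagged q).2 l)) ->
  (sat (tagged q).1 (tcat (entryof f j i) (f \o (tagged q).2)) <->
   sat (tagged q).1 (tcat (entryof f j 0) (f \o (tagged q).2))).

Let small_sk : smallT K sk.
Proof. exact: smallT_embeds (embeds_skterm _ (embeds_countType _)) Ksmall. Qed.

Let small_vars0 V : smallT K V -> smallT K (V + {c : C | set0 c}).
Proof.
apply: smallT_embeds.
by exists (fun w => match w with inl v => v | inr (exist _ h) => match (h : False) with end end);
  move=> [v|[? []]] [v'|[? []]] // ->.
Qed.

Section Array.
Variable a : seq nat -> 'I_m -> C.
Hypothesis ak : forall s, k_inconsistent phi k (fun i => a (rcons s i)).
Hypothesis ac : forall eta : nat -> nat, consistent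
  [set P | exists2 j, 1 <= j & P = PFormula phi (a (mkseq eta j))].

Lemma branch_realized (eta : nat -> nat) :
  exists c : 'I_n -> C, forall j, sat phi (tcat c (a (mkseq eta j.+1))).
Proof.
pose A := set0 `|` range (fun w : nat * 'I_m => a (mkseq eta w.1) w.2).
have sA : small K A.
  by apply/smallP; apply: (small_range Knat _ (embeds_countType _)); apply: small0.
have [P [j _ ->]|c cE] := Ksat sA _ (@ac eta).
  by move=> l; right; exists (j, l).
by exists c => j; apply: (cE (PFormula phi (a (mkseq eta j.+1)))); exists j.+1.
Qed.

(* At every node pass to infinitely many successors not distinguished by the
   finitely many tests with parameters in the Skolem hull of the nodes below. *)
Lemma finite_array N (q : 'I_N -> test) : exists f : sk -> C,
  [/\ skolem_closed f id, forall j, k_inconsistent phi k (entryof f j),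
      forall j, sat phi (tcat (pointof f) (entryof f j 0)) &
      forall r, passes (q r) f].
Proof.
have [W WE] := skolem_functions C.
have [c0] := dom_inhabited C.
(* At a node only the branch below it is known. Coordinates of the point get the filler [c0], and
   sibling indices are ignored; the relevant terms mention neither siblings nor the point. *)
pose beta s (b : name) : C :=
  match b with inl (j, _, l) => a (take j.+1 s) l | inr _ => c0 end.
pose color s i : {ffun 'I_N -> bool} := [ffun r => `[< sat (tagged (q r)).1
  (tcat (a (rcons s i)) (skeval W (beta s) \o (tagged (q r)).2)) >]].
have /choice [h hE] : forall s, exists h : nat -> nat,
    {homo h : i j / i < j} /\ forall i, color s (h i) = color s (h 0).
  move=> s; have [c [h [hh hc]]] := infinite_pigeonhole (color s).
  by exists h; split=> // i; rewrite !hc.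
(* The branch always takes the first of the selected successors, which thus becomes sibling 0 of its
   row. *)
pose path j := iter j (fun s => rcons s (h s 0)) [::].
pose eta j := h (path j) 0.
have pathE j : path j = mkseq eta j.
  by elim: j => // j IH; rewrite mkseqS /path iterS -/(path j) IH /eta IH.
have [c cE] := branch_realized eta.
pose gam (b : name) : C :=
  match b with inl (j, i, l) => a (rcons (path j) (h (path j) i)) l | inr l => c l end.
have gam0 j l : gam (inl (j, 0, l)) = a (path j.+1) l by [].
exists (skeval W gam); split.
- by move=> r psi ts h'; apply: WE.
- by move=> j; apply: (k_inconsistent_sub (hE (path j)).1 (@ak (path j))).
- move=> j; rewrite (_ : entryof _ j 0 = a (mkseq eta j.+1)); first exact: cE.
  by rewrite -pathE.
- move=> r j i lo.
  have E : skeval W gam \o (tagged (q r)).2 = skeval W (beta (path j)) \o (tagged (q r)).2.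
    apply/funext => l /=; apply: skeval_local (lo l) => b [j' [l' [j'j ->]]].
    by rewrite gam0 /beta !pathE take_mkseq.
  have := (hE (path j)).2 i => /ffunP /(_ r); rewrite !ffunE -E.
  by move=> H; split=> /asboolP; [rewrite H|rewrite -H] => /asboolP.
Qed.

(** Finite lists of tests form a directed family, and each requirement is a conjunction of definable
    conditions without parameters, so compactness imposes all tests at once. *)
Lemma array : exists f : sk -> C,
  [/\ skolem_closed f id, forall j, k_inconsistent phi k (entryof f j),
      forall j, sat phi (tcat (pointof f) (entryof f j 0)) &
      forall q, passes q f].
Proof.
have [||[N q] [N' q'] _ _|[N q] _|f fE] := @compact_base K L C Ksat set0 sk _ setT
  (fun d : {N & 'I_N -> test} => [set f : sk -> C |
    [/\ skolem_closed f id, forall j, k_inconsistent phi k (entryof f j),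
      forall j, sat phi (tcat (pointof f) (entryof f j 0)) &
      forall r, passes (tagged d r) f]]).
- exact: small_vars0.
- by exists (existT _ 0 (@noord _)).
- exists (existT _ (N + N') (tcat q q')) => // f [f1 f2 f3 f4].
  split; split=> // r.
    by have := f4 (lshift N' r); rewrite /= tcat_lshift.
  by have := f4 (rshift N r); rewrite /= tcat_rshift.
- by have [f fP] := finite_array q; exists f.
have none : setT (existT _ 0 (@noord _) : {N & 'I_N -> test}) by [].
exists f; split.
- move=> r psi ts; apply: (fE _ (@def_skolem L C sk name id r psi ts) _ none).
  by move=> g [g1 _ _ _]; apply: g1.
- move=> j s sh.
  have dX := def_consistent (C := C) set0 phi
    (fun (l : 'I_k) i => Base (inl (j, s l, i)) : sk).
  apply: (fE _ (def_not dX) _ none) => g [_ g2 _ _].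
  exact: (g2 j s sh).
- move=> j.
  have dX := def_sat (C := C) set0 phi
    (tcat (fun l => Base (inr l)) (fun l => Base (inl (j, 0, l))) : _ -> sk).
  have E (g : sk -> C) : g \o tcat (fun l => Base (inr l))
      (fun l => Base (inl (j, 0, l))) = tcat (pointof g) (entryof g j 0).
    by rewrite tcat_comp.
  rewrite -E; apply: (fE _ dX _ none) => g [_ _ g3 _].
  by rewrite /mkset E.
- move=> q j i lo.
  pose t i' : 'I_(m + tag q) -> sk :=
    tcat (fun l => Base (inl (j, i', l))) (tagged q).2.
  have E (g : sk -> C) i' : g \o t i' = tcat (entryof g j i') (g \o (tagged q).2).
    by rewrite tcat_comp.
  pose X i' := [set g : sk -> C | sat (tagged q).1 (g \o t i')].
  have dX i' : definable set0 (X i') by apply: def_sat.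
  rewrite -!E; pose one : {N & 'I_N -> test} := existT _ 1 (fun=> q).
  split; [apply: (fE _ (def_imp (dX i) (dX 0)) one)|
          apply: (fE _ (def_imp (dX 0) (dX i)) one)] => // g [_ _ _ /(_ ord0)] /=;
    by move=> /(_ j i lo) [H1 H2]; rewrite /X /mkset !E.
Qed.

(* The pair (b, b_i) is the limit of (a_{j,0}, a_{j,i}) along an ultrafilter on j.
   Taking the limit also replaces the hull by an elementarily equivalent one. *)
Lemma tree_coheir : exists (M : set C) (b : 'I_m -> C) (c : 'I_n -> C),
  [/\ tarski_vaught M, smallC K M, divides (tp c (M `|` range b)) M &
      forall P : pformula C (n + m), pover M P -> pholds P (tcat c b) ->
        exists b', tuple_in M b' /\ pholds P (tcat c b')].
Proof.
have [f [fS fk fc fp]] := array.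
pose V := (sk + nat * 'I_m)%type.
(* Row [j] is copied into fresh variables; in the limit over [j] these variables name the sequence
   of the [bg i]. *)
pose z j : V -> C := scase f (fun w => entryof f j w.1 w.2).
have [U [UU sub]] := ultraFilterLemma (@eventually_filter).
have UP : ProperFilter U := @ultra_proper _ _ UU.
have sV : smallT K (V + {c : C | set0 c}).
  by apply: small_vars0; apply: smallT_sum_nat => //; apply: embeds_countType.
have [g gE] := compactness (F := [set X | U [set j | X (z j)]]) Ksat sV
  (fmap_proper_filter z UP).
(* Compactness only sends truth for almost all [j] to the limit. The converse needs an
   ultrafilter. *)
have gU X : definable set0 X -> X g -> U [set j | X (z j)].
  move=> dX Xg; have [//|nX] := in_ultra_setVsetC [set j | X (z j)] UU.
  by exfalso; apply: (gE _ (def_not dX)) Xg.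
have gall X : definable set0 X -> (forall j, X (z j)) -> X g.
  move=> dX Xz; apply: gE => //.
  exact: (filterS (F := U) (fun j _ => Xz j) filterT).
pose cg : 'I_n -> C := fun l => g (inl (Base (inr l))).
pose bg i : 'I_m -> C := fun l => g (inr (i, l)).
pose eg j : 'I_m -> C := fun l => g (inl (Base (inl (j, 0, l)))).
pose root (b : name) := exists j l, b = inl (j, 0, l).
pose M : set C := [set g (inl t) | t in [set t : sk | skin root t]].
have Mn r (v : 'I_r -> C) : tuple_in M v -> exists ts : 'I_r -> sk,
    (forall i, skin root (ts i)) /\ v = g \o inl \o ts.
  move=> Mv; have /choice [ts tsE] : forall i, exists t, skin root t /\ g (inl t) = v i.
    by move=> i; have [t ht E] := Mv i; exists t.
  exists ts; split=> [i|]; first exact: (tsE i).1.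
  by apply/funext => i /=; rewrite (tsE i).2.
(* Finitely many terms mention finitely many rows, so their values lie below all sufficiently late
   rows, where the tests apply. *)
have low r (ts : 'I_r -> sk) : (forall i, skin root (ts i)) ->
    exists J, forall j, J <= j -> forall i, skin (below j) (ts i).
  move=> h; have /choice [J JE] : forall i, exists J, skin (below J) (ts i).
    move=> i; elim: (ts i) (h i) => [b [j [l ->]]|p psi us IH /= hus].
      by exists j.+1; exists j, l.
    have /choice [J JE] := fun i' => IH i' (hus i').
    exists (\max_i' J i') => i'; apply: skin_sub (JE i') => b [j' [l [j'J ->]]].
    by exists j', l; split=> //; apply: leq_trans j'J _; apply: leq_bigmax.
  exists (\max_i J i) => j Jj i; apply: skin_sub (JE i) => b [j' [l [j'J ->]]].
  exists j', l; split=> //; apply: leq_trans j'J _; apply: leq_trans Jj.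
  exact: leq_bigmax.
have tv : tarski_vaught M.
  move=> r psi v /Mn [ts [hts ->]] ex; exists (g (inl (Wit psi ts))).
  split; first by exists (Wit psi ts).
  have := gall _ (@def_skolem L C V name inl r psi ts); apply=> // j.
  by move=> h; apply: (fS r psi ts).
have conj_b i : eqtp M (bg 0) (bg i).
  move=> X /pform_def [P [/Mn [ts [hts pE]] PX]] /PX; rewrite /pholds pE => h0.
  apply/PX; rewrite /pholds pE.
  pose t i' : 'I_(m + pnum P) -> V := tcat (fun l => inr (i', l)) (inl \o ts).
  have E (w : V -> C) i' : w \o t i' = tcat (fun l => w (inr (i', l))) (w \o inl \o ts).
    by rewrite tcat_comp.
  pose Y i' := [set w : V -> C | sat (pbody P) (w \o t i')].
  have dY i' : definable set0 (Y i') by apply: def_sat.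
  have : Y i g.
    apply: (gE _ (def_imp (dY 0) (dY i))); last by rewrite /Y /mkset E.
    have [J JE] := low _ _ hts.
    apply: (filterS (F := U) _ (sub [set j | J <= j] _)); last by exists J.
    move=> j /= Jj; rewrite /Y /mkset !E.
    exact: (fp (existT _ _ (pbody P, ts)) j i (JE j Jj)).2.
  by rewrite /Y /mkset E.
exists M, (bg 0), cg; split=> //.
- apply: smallT_embeds small_sk.
  have /choice [h hE] : forall y : {y | M y}, exists t, g (inl t) = sval y.
    by move=> y; have [t _ E] := proj2_sig y; exists t.
  by exists h => y y' E; apply: sval_inj; rewrite -!hE E.
- exists (PFormula phi (bg 0)); split.
    apply/formula_dividesP; exists k, bg; split=> // s sh.
    have dX := def_consistent (C := C) set0 phi
      (fun (l : 'I_k) i => inr (s l, i) : V).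
    apply: (gall _ (def_not dX)) => j /=; exact: (fk j s sh).
  move=> x xE; apply: (xE (PFormula phi (bg 0))); split.
    by move=> l; right; exists l.
  have dX := def_sat (C := C) set0 phi
    (tcat (fun l => inl (Base (inr l))) (fun l => inr (0, l)) : _ -> V).
  have E (w : V -> C) : w \o tcat (fun l => inl (Base (inr l))) (fun l => inr (0, l)) =
      tcat (fun l => w (inl (Base (inr l)))) (fun l => w (inr (0, l))).
    by rewrite tcat_comp.
  have : sat phi (g \o tcat (fun l => inl (Base (inr l))) (fun l => inr (0, l))).
    by apply: (gall _ dX) => j; rewrite /mkset E; apply: fc.
  by rewrite E.
- move=> P /Mn [ts [hts pE]]; rewrite /pholds pE.
  pose t (v : 'I_m -> V) : 'I_(n + m + pnum P) -> V :=
    tcat (tcat (fun l => inl (Base (inr l))) v) (inl \o ts).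
  have E (w : V -> C) v : w \o t v =
      tcat (tcat (fun l => w (inl (Base (inr l)))) (w \o v)) (w \o inl \o ts).
    by rewrite /t !tcat_comp.
  rewrite -(E g (fun l => inr (0, l))).
  (* The formula true of the limit [bg 0] is true of some branch term in the original array. It
     passes back to the limit, at [eg j], because it then no longer involves the fresh variables and
     holds under every [z j']. *)
  move=> /(gU _ (def_sat set0 (pbody P) _)) /filter_ex [j]; rewrite /mkset E => hj.
  exists (eg j); split.
    by move=> l; exists (Base (inl (j, 0, l))) => //; exists j, l.
  rewrite -(E g (fun l => inl (Base (inl (j, 0, l))))).
  apply: (gall _ (def_sat set0 (pbody P) _)) => j'.
  by rewrite /mkset E.
Qed.

End Array.
End TreeProperty.

(** * From weak dual finite character to simplicity *)

Section WeakDFC.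
Variables (K : Type) (L : language) (C : structure L).
Hypothesis Ksmall : smallT K (fsym L + rsym L + nat).
Hypothesis Ksat : saturated K C.

Lemma weak_dfc_simple : weak_dual_finite_character K C -> simple_theory C.
Proof.
move=> wdfc n m phi [k [a [_ ak ac]]].
have [M [b [c [tv sM dv coh]]]] := tree_coheir Ksmall Ksat ak ac.
have eM := tarski_vaught_elementary tv.
have [P [PM Pcb Pnf]] := wdfc M m n b c eM ((smallP _ _).2 sM) dv.
have [b' [Mb' Pcb']] := coh P PM Pcb.
apply: (Pnf b' Pcb') => q /finite_set_enum [N [u uE]] qc.
have uP i : pover M (u i) /\ pholds (u i) c.
  have /qc [uM uc] : q (u i) by apply/uE; exists i.
  by split=> // l; have [//|[j _ <-]] := uM l; apply: Mb'.
have [|x [Mx xu]] := tarski_vaught_definable tv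
  (def_all (fun i => def_pholds (uP i).1)).
  by exists c => i; apply: (uP i).2.
by exists x; split=> // P' /uE [i <-]; apply: xu.
Qed.

End WeakDFC.

Theorem theorem10 (L : language) (T : set (sentence L)) (K : Type)
    (C : structure L) (hT : complete_theory T) (hC : monster_model K T C) :
  (simple_theory C <-> dual_finite_character K C) /\
  (dual_finite_character K C <-> weak_dual_finite_character K C).
Proof.
have [Klarge _ Ksat Khom] := hC.
have Ksmall : smallT K (fsym L + rsym L + nat).
  exact: smallT_embeds (embeds_setT _).1 ((smallP _ _).1 Klarge).
have Knat : smallT K nat by apply: smallT_embeds Ksmall; exists inr => i j [].
have sd := simple_dfc Knat Ksat Khom.
have dw := dfc_weak_dfc Knat Ksat.
have ws := weak_dfc_simple Ksmall Ksat.
by split; split=> h; auto.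
Qed.
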